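(* Let $X=\mathbb{R}^n/\Lambda$ be a tropical torus and let $L\to X$ be a tropical line bundle. If $\Gamma(X,L)\neq\{-\infty\}$, then $\Gamma(X,L)$ is identified (via the injection $\varphi$ described in the context) with a convex polyhedron, and the projectivization $\mathbb{P}(\Gamma(X,L))$ is identified with a compact convex polyhedron; in particular it is pure-dimensional.
   Context: $\mathbb{T}=\mathbb{R}\cup\{-\infty\}$ with tropical sum $\max$ and tropical product $+$. A tropical torus is $X=\mathbb{R}^n/\Lambda$ with $\Lambda\subset\mathbb{R}^n$ a lattice of rank $n$; its integral affine structure comes from the standard lattice $\mathbb{Z}^n$. Real-valued regular functions are continuous functions that are locally maxima of finitely many $\mathbb{Z}$-affine linear functions $x\mapsto a\cdot x+c$ ($a\in(\mathbb{Z}^n)^*$, $c\in\mathbb{R}$). Tropical line bundles on $X$ are the bundles with fiber $\mathbb{T}$ glued by transition functions $t\mapsto t+\varphi_{ij}(x)$ with $\varphi_{ij}$ $\mathbb{Z}$-affine linear. Every tropical line bundle on $X$ is isomorphic to some $L(Q,\alpha)$, where $Q:\Lambda\times\mathbb{Z}^n\to\mathbb{Z}$ is a bilinear form whose $\mathbb{R}$-bilinear extension $Q_{\mathbb{R}}$ to $\mathbb{R}^n\times\mathbb{R}^n$ is symmetric, $\alpha\in(\mathbb{R}^n)^*$, and $L(Q,\alpha)$ is the quotient of $\mathbb{R}^n\times\mathbb{T}$ by the $\Lambda$-action $\lambda\cdot(x,t)=(x+\lambda,\ t+Q_{\mathbb{R}}(\lambda,x)+\tfrac12Q_{\mathbb{R}}(\lambda,\lambda)+\alpha(\lambda))$.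 One has $L(Q,\alpha)\cong L(Q,\alpha+\gamma)$ for $\gamma\in(\mathbb{Z}^n)^*$. The $\mathbb{T}$-module $\Gamma(X,L(Q,\alpha))$ of global regular sections is the set of theta functions, i.e. regular functions $\Theta:\mathbb{R}^n\to\mathbb{R}$ with $\Theta(x+\lambda)=\Theta(x)+Q_{\mathbb{R}}(\lambda,x)+\tfrac12Q_{\mathbb{R}}(\lambda,\lambda)+\alpha(\lambda)$ for all $\lambda\in\Lambda,x\in\mathbb{R}^n$, together with the element $-\infty$. Its projectivization is $(\Gamma\setminus\{-\infty\})/\sim$, where $\Theta\sim\Theta+t$ for $t\in\mathbb{R}$. The identification: let $q:\Lambda\to(\mathbb{Z}^n)^*$, $q(\lambda)=Q(\lambda,\cdot)$, and let $q_{\mathbb{R}}:\mathbb{R}^n\to(\mathbb{R}^n)^*$ be its linear extension. If $\Gamma(X,L(Q,\alpha))\ne\{-\infty\}$, then $Q_{\mathbb{R}}$ is positive semidefinite and $\alpha\in\operatorname{Im}(q_{\mathbb{R}})+(\mathbb{Z}^n)^*$, so up to isomorphism one may take $\alpha=q_{\mathbb{R}}(r)$ with $r\in\mathbb{R}^n$. Let $B\subset\operatorname{Im}(q_{\mathbb{R}})\cap(\mathbb{Z}^n)^*$ be a (finite) set of representatives of $(\operatorname{Im}(q_{\mathbb{R}})\cap(\mathbb{Z}^n)^* )/q(\Lambda)$. For $b\in B$ choose $c_b\in\mathbb{R}^n$ with $q_{\mathbb{R}}(c_b)=b$ and put $$\Theta_b(x)=\max_{\lambda\in\Lambda}\{(b+q(\lambda))\cdot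 x-\tfrac12Q_{\mathbb{R}}(\lambda+c_b-r,\lambda+c_b-r)\},$$ which is a theta function independent of the choice of $c_b$. Define $\varphi:\Gamma(X,L)\to\mathbb{T}^B$ by $\varphi(\Theta)=(\varphi^b(\Theta))_{b\in B}$, $\varphi^b(\Theta)=\min_{x\in\mathbb{R}^n}\{\Theta(x)-\Theta_b(x)\}$, and $\varphi(-\infty)=(-\infty,\dots,-\infty)$. The map $\varphi$ is injective, and satisfies $\varphi(\Theta+t)=\varphi(\Theta)+(t,\dots,t)$. ''$\Gamma(X,L)$ is identified with a convex polyhedron'' means that $\varphi(\Gamma(X,L)\setminus\{-\infty\})\subset\mathbb{R}^B$ is a finite intersection of closed half-spaces; the projectivization is identified with the image of this set in $\mathbb{R}^B/\mathbb{R}(1,\dots,1)\cong\mathbb{R}^{|B|-1}$ (equivalently, with its slice where one fixed coordinate is $0$). *)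

(* Defs.v *)
From mathcomp Require Import all_boot all_order all_algebra.
From mathcomp Require Import all_classical all_reals all_analysis.
Import Order.TTheory GRing.Theory Num.Theory.
Import numFieldNormedType.Exports.
Set Implicit Arguments.
Unset Strict Implicit.
Unset Printing Implicit Defensive.
Local Open Scope classical_set_scope.
Local Open Scope ring_scope.

(* MathComp-Analysis.  Points of R^n and covectors in (R^n)^* are both row
   vectors; a covector a acts on a point x by pairing a x = a . x.  Thus Z^n and
   (Z^n)^* are both the set integral n.  The tropical semifield
   T = R u {-oo} is regarded as a subset of \bar R. *)

Section Polyhedra.
Context {R : realType}.

Definition pairing n (a x : 'rV[R]_n) : R := \sum_(i < n) a 0 i * x 0 i.

Definition halfspace m (h : 'rV[R]_m * R) : set 'rV[R]_m :=
  [set x | pairing h.1 x <= h.2].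

Definition is_polyhedron m (P : set 'rV[R]_m) : Prop :=
  exists s : seq ('rV[R]_m * R),
    {in s, forall h, h.1 != 0} /\ P = \bigcap_(h in [set` s]) halfspace h.

(* A contains a (nondegenerate) d-dimensional simplex. *)
Definition has_simplex m (d : nat) (A : set 'rV[R]_m) : Prop :=
  exists v : 'I_d.+1 -> 'rV[R]_m,
    row_free (\matrix_(i < d) (v (lift ord0 i) - v ord0)) /\
    forall w : 'I_d.+1 -> R, (forall i, 0 <= w i) -> \sum_i w i = 1 ->
      A (\sum_i w i *: v i).

(* A has dimension d, and local dimension d at each of its points.  The
   dimension of a (not necessarily convex) polyhedral set is the largest
   dimension of a simplex contained in it. *)
Definition pure_dimensional m (A : set 'rV[R]_m) : Prop :=
  exists d : nat, ~ has_simplex d.+1 A /\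
    forall x, A x -> forall U, nbhs x U -> has_simplex d (A `&` U).

End Polyhedra.

Section ThetaFunctions.
Context {R : realType} {n : nat}.
Local Notation V := 'rV[R]_n.

Definition integral : set V := [set a | a \is a mxOver Num.int].

Definition is_lattice (Lam : set V) : Prop :=
  exists2 M : 'M[R]_n, M \in unitmx &
    Lam = [set z *m M | z in integral].

(* Matrix of the R-bilinear form Q_R. *)
Definition QR (S : 'M[R]_n) (x y : V) : R := (x *m S *m y^T) 0 0.

(* Since Lam and Z^n both span R^n, bilinear forms Q : Lam x Z^n -> Z correspond
   bijectively to real matrices S whose form is integer valued on Lam x Z^n:
   S is the matrix of the extension Q_R, and Q its restriction. *)
Definition is_polarization (Lam : set V) (S : 'M[R]_n) : Prop :=
  (forall x y, QR S x y = QR S y x) /\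
  (forall l z, Lam l -> integral z -> QR S l z \is a Num.int).

Definition qR (S : 'M[R]_n) (x : V) : V := x *m S.

Definition affine_eval (p : V * R) (x : V) : R := pairing p.1 x + p.2.

Definition regular (f : V -> R) : Prop :=
  continuous f /\
  forall x0 : V, exists (p : V * R) (s : seq (V * R)),
    {in p :: s, forall p', integral p'.1} /\
    \forall x \near x0,
      f x = \big[Num.max/affine_eval p x]_(p' <- s) affine_eval p' x.

Definition is_theta (Lam : set V) (S : 'M[R]_n) (alpha : V) (f : V -> R) :=
  regular f /\
  forall l x, Lam l ->
    f (x + l) = f x + QR S l x + 2^-1 * QR S l l + pairing alpha l.

Definition minus_infty : V -> \bar R := fun=> -oo%E.

(* Gamma(X, L(Q, alpha)) *)
Definition Gamma (Lam : set V) (S : 'M[R]_n) (alpha : V) : set (V -> \bar R) :=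
  minus_infty |` [set EFin \o f | f in is_theta Lam S alpha].

(* The relation whose quotient is the projectivization. *)
Definition proj_equiv (s s' : V -> \bar R) : Prop :=
  exists t : R, s' = (fun x => s x + t%:E)%E.

(* B enumerates, without repetition, representatives of
   (Im q_R n (Z^n)^* ) / q(Lam).  That group is nonempty, whence k.+1. *)
Definition is_representatives (Lam : set V) (S : 'M[R]_n) k
    (B : 'I_k.+1 -> V) : Prop :=
  (forall i, (range (qR S) `&` integral) (B i)) /\
  (forall a, (range (qR S) `&` integral) a ->
    exists! i, (qR S @` Lam) (a - B i)).

(* The choices entering the definition of phi.  The integral covector gamma
   realizes the isomorphism L(Q, alpha) = L(Q, q_R(r)). *)
Record theta_choices (Lam : set V) (S : 'M[R]_n) (alpha r gamma : V) k
    (B c : 'I_k.+1 -> V) : Prop := {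
  _ : integral gamma;
  _ : alpha = qR S r + gamma;
  _ : is_representatives Lam S B;
  _ : forall i, qR S (c i) = B i }.

Definition theta_term (S : 'M[R]_n) (r b c l x : V) : R :=
  pairing (b + qR S l) x - 2^-1 * QR S (l + c - r) (l + c - r).

Definition Theta (Lam : set V) (S : 'M[R]_n) (r b c : V) (x : V) : \bar R :=
  ereal_sup [set (theta_term S r b c l x)%:E | l in Lam].

(* s |-> s - gamma maps Gamma(L(Q, q_R(r) + gamma)) onto Gamma(L(Q, q_R(r))). *)
Definition untwist (gamma : V) (s : V -> \bar R) : V -> \bar R :=
  fun x => (s x - (pairing gamma x)%:E)%E.

Section Phi.
Variables (Lam : set V) (S : 'M[R]_n) (r gamma : V).
Variables (k : nat) (B c : 'I_k.+1 -> V).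

(* On s = -oo this gives (-oo, .., -oo). *)
Definition phi (s : V -> \bar R) : 'I_k.+1 -> \bar R :=
  fun i => ereal_inf
    [set (untwist gamma s x - Theta Lam S r (B i) (c i) x)%E | x in setT].

(* phi followed by R^B -> R^B / R(1, .., 1), the latter identified with
   R^(|B| - 1) by a |-> (a_j - a_i0) for j != i0. *)
Definition proj_phi (i0 : 'I_k.+1) (s : V -> \bar R) : 'rV[R]_k :=
  \row_j (fine (phi s (lift i0 j)) - fine (phi s i0)).

End Phi.
End ThetaFunctions.

Definition toT (R : realType) m (a : 'rV[R]_m) : 'I_m -> \bar R :=
  fun i => (a 0 i)%:E.

(* Main.v *)
(* A regular theta function f for L(Q, alpha) is convex, since it has local
   support lines, and f - Q/2 - alpha is periodic, hence bounded. Comparing f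
   with a support of integral slope m along a line shows that Q is positive
   semidefinite and that m - alpha lies in Im q_R. Expanding over these
   supports gives f = max_b (Theta_b + a_b) with a = phi(f), and the vectors a
   which occur are those for which every a_i + Theta_i attains the maximum at
   some point x. Translating by the lattice, one may assume that Theta_i is
   there given by its term of index 0; then x is bounded modulo the kernel of
   q_R, so only finitely many inequalities in (a, x) matter, and Fourier-Motzkin
   elimination of x yields a polyhedron. The differences a_j - a_i are bounded by
   those of the periodic functions Theta_i - Theta_j, whence compactness. *)

Require Import Defs.
From mathcomp Require Import all_boot all_order all_algebra.
From mathcomp Require Import all_classical all_reals all_analysis.
From mathcomp Require Import zify ring lra.
Import Order.TTheory GRing.Theory Num.Theory.
Import numFieldNormedType.Exports.
Set Implicit Arguments.
Unset Strict Implicit.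
Unset Printing Implicit Defensive.
Local Open Scope classical_set_scope.
Local Open Scope ring_scope.

(* The bare name is taken by the Lebesgue integral. *)
Local Notation integral := Defs.integral.

(** * Linear inequalities *)

Section Pairing.
Context {R : realType} {n : nat}.
Implicit Types (a b x y : 'rV[R]_n).

Lemma pairingE a x : pairing a x = (a *m x^T) 0 0.
Proof. by rewrite mxE; apply: eq_bigr => i _; rewrite mxE. Qed.

Lemma pairingC a x : pairing a x = pairing x a.
Proof. by apply: eq_bigr => i _; rewrite mulrC. Qed.

Lemma pairingDl a b x : pairing (a + b) x = pairing a x + pairing b x.
Proof. by rewrite !pairingE mulmxDl mxE. Qed.

Lemma pairingZl t a x : pairing (t *: a) x = t * pairing a x.
Proof. by rewrite !pairingE -scalemxAl mxE. Qed.

Lemma pairingNl a x : pairing (- a) x = - pairing a x.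
Proof. by rewrite -scaleN1r pairingZl mulN1r. Qed.

Lemma pairingBl a b x : pairing (a - b) x = pairing a x - pairing b x.
Proof. by rewrite pairingDl pairingNl. Qed.

Lemma pairing0l x : pairing 0 x = 0.
Proof. by rewrite pairingE mul0mx mxE. Qed.

Lemma pairingDr a x y : pairing a (x + y) = pairing a x + pairing a y.
Proof. by rewrite !(pairingC a) pairingDl. Qed.

Lemma pairingZr t a x : pairing a (t *: x) = t * pairing a x.
Proof. by rewrite !(pairingC a) pairingZl. Qed.

Lemma pairingNr a x : pairing a (- x) = - pairing a x.
Proof. by rewrite !(pairingC a) pairingNl. Qed.

Lemma pairingBr a x y : pairing a (x - y) = pairing a x - pairing a y.
Proof. by rewrite pairingDr pairingNr. Qed.

Lemma pairing0r a : pairing a 0 = 0.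
Proof. by rewrite pairingC pairing0l. Qed.

Lemma pairing_continuous a : continuous (pairing a).
Proof.
apply: (@continuous_big R^o 'I_n +%R 0 predT _ 'rV[R]_n) => [|i _ x].
  exact: (@add_continuous R^o).
exact: (@cvgM R _ (nbhs x) _ (fun=> a 0 i) (fun x : 'rV_n => x 0 i)
  _ _ (cvg_cst _) (@coord_continuous _ _ _ _ _ x)).
Qed.

End Pairing.

Section LinearSystems.
Context {R : realType}.

(** Zero normals are allowed here, unlike in [is_polyhedron], because Fourier-Motzkin elimination
    can produce them. *)
Definition solset m (s : seq ('rV[R]_m * R)) : set 'rV[R]_m :=
  [set a | forall h, h \in s -> pairing h.1 a <= h.2].

Lemma solset_cat m (s s' : seq ('rV[R]_m * R)) :
  solset (s ++ s') = solset s `&` solset s'.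
Proof.
apply/seteqP; split=> [a h|a [h1 h2] h]; last by rewrite mem_cat => /orP[/h1|/h2].
by split=> g gs; apply: h; rewrite mem_cat gs ?orbT.
Qed.

Lemma solset_polyhedron m (s : seq ('rV[R]_m * R)) :
  solset s !=set0 -> is_polyhedron (solset s).
Proof.
move=> [a0 ha0]; exists [seq h <- s | h.1 != 0].
split; first by move=> h; rewrite mem_filter => /andP[].
apply/seteqP; split=> [a ha h /=|a ha h hs].
  by rewrite mem_filter => /andP[_ /ha].
have [h0|h0] := eqVneq h.1 0; last by apply: (ha h); rewrite /= mem_filter h0.
by have := ha0 _ hs; rewrite h0 !pairing0l.
Qed.

Lemma solset_closed m (s : seq ('rV[R]_m * R)) : closed (solset s).
Proof.
have -> : solset s = \bigcap_(h in [set` s]) [set a | pairing h.1 a <= h.2].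
  by apply/seteqP; split=> a ha h; apply: ha.
apply: closed_bigI => h _.
apply: (@preimage_closed _ _ (pairing h.1) [set x | x <= h.2]).
- move=> ? _; exact: pairing_continuous.
- exact: closed_le.
Qed.

Lemma seq_between (lo up : seq R) :
  (forall l u, l \in lo -> u \in up -> l <= u) ->
  exists t, (forall l, l \in lo -> l <= t) /\ (forall u, u \in up -> t <= u).
Proof.
elim: lo => [|l lo IH] lu.
  elim: up {lu} => [|u up [t [_ tu]]]; first by exists 0.
  exists (Num.min u t); split=> // v; rewrite inE ge_min => /predU1P[->|/tu->].
    by rewrite lexx.
  by rewrite orbT.
have [|t [lt tu]] := IH.
  by move=> l' u l'lo; apply: lu; rewrite inE l'lo orbT.
exists (Num.max l t); split=> [l'|u uup].
  rewrite inE le_max => /predU1P[->|/lt->]; first by rewrite lexx.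
  by rewrite orbT.
by rewrite ge_max tu // andbT; apply: lu => //; rewrite mem_head.
Qed.

(** Dividing by the coefficient of [t] turns [P] into upper bounds and [N] into lower bounds for
    [t]. A suitable [t] exists exactly when each lower bound is at most each upper bound; clearing
    denominators makes this linear in [a]. *)
Lemma fourier_motzkin1 m (s : seq ('rV[R]_m * R * R)) :
  exists s', forall a,
    (exists t, forall h, h \in s -> pairing h.1.1 a + h.1.2 * t <= h.2) <->
    solset s' a.
Proof.
pose P := [seq h <- s | 0 < h.1.2]; pose N := [seq h <- s | h.1.2 < 0].
exists ([seq (h.1.1, h.2) | h <- s & h.1.2 == 0] ++
  [seq (p.1.2 *: q.1.1 - q.1.2 *: p.1.1, p.1.2 * q.2 - q.1.2 * p.2) |
     p <- P, q <- N]) => a.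
rewrite solset_cat; split=> [[t ht]|[h0 h1]].
  split=> h.
    move=> /mapP[g]; rewrite mem_filter => /andP[/eqP g0 /ht] + ->.
    by rewrite g0 mul0r addr0.
  move=> /allpairsP[[p q] /= []]; rewrite !mem_filter.
  move=> /andP[p0 /ht hp] /andP[q0 /ht hq] -> /=.
  rewrite pairingBl !pairingZl; nra.
have [|t [lt tu]] := @seq_between
    [seq (q.2 - pairing q.1.1 a) / q.1.2 | q <- N]
    [seq (p.2 - pairing p.1.1 a) / p.1.2 | p <- P].
  move=> _ _ /mapP[q qN ->] /mapP[p pP ->].
  have := h1 _ (allpairs_f (fun p q => (_, _)) pP qN).
  rewrite /= pairingBl !pairingZl; move: qN pP; rewrite !mem_filter.
  move=> /andP[q0 _] /andP[p0 _] h.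
  rewrite ler_pdivlMr // mulrAC ler_ndivrMr //; nra.
exists t => h hs; have [hn|hp|h0'] := ltgtP h.1.2 0.
- have : (h.2 - pairing h.1.1 a) / h.1.2 <= t.
    by apply: lt; apply/mapP; exists h => //; rewrite mem_filter hn.
  by rewrite ler_ndivrMr //; lra.
- have : t <= (h.2 - pairing h.1.1 a) / h.1.2.
    by apply: tu; apply/mapP; exists h => //; rewrite mem_filter hp.
  by rewrite ler_pdivlMr //; lra.
- rewrite h0' mul0r addr0; apply: (h0 (h.1.1, h.2)).
  by apply/mapP; exists h => //; rewrite mem_filter h0' eqxx.
Qed.

Lemma pairing_row_mx m k (a a' : 'rV[R]_m) (b b' : 'rV[R]_k) :
  pairing (row_mx a b) (row_mx a' b') = pairing a a' + pairing b b'.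
Proof. by rewrite !pairingE tr_row_mx mul_row_col mxE. Qed.

(** The first coordinate of [x] is appended to the parameters [a], the others are eliminated by
    induction, and [fourier_motzkin1] removes the remaining one. *)
Lemma fourier_motzkin n m (s : seq ('rV[R]_m * 'rV[R]_n * R)) :
  exists s', forall a,
    (exists x, forall h, h \in s -> pairing h.1.1 a + pairing h.1.2 x <= h.2) <->
    solset s' a.
Proof.
elim: n m s => [|n IH] m s.
  exists [seq (h.1.1, h.2) | h <- s] => a.
  split=> [[x hx] _ /mapP[h /hx + ->]|ha].
    by rewrite [x]thinmx0 pairing0r addr0.
  exists 0 => h hs; rewrite pairing0r addr0.
  by apply: (ha (h.1.1, h.2)); apply/mapP; exists h.
pose s1 := [seq (row_mx h.1.1 (lsubmx (h.1.2 : 'rV_(1 + n))),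
                 rsubmx (h.1.2 : 'rV_(1 + n)), h.2) | h <- s].
have [s2 hs2] := IH _ s1.
have [s3 hs3] := fourier_motzkin1
  [seq (lsubmx h.1, rsubmx h.1 0 0, h.2) | h <- s2].
exists s3 => a; rewrite -hs3.
have key t : (forall h, h \in [seq (lsubmx h.1, rsubmx h.1 0 0, h.2) | h <- s2] ->
     pairing h.1.1 a + h.1.2 * t <= h.2) <-> solset s2 (row_mx a (t%:M)).
  have e (h : 'rV[R]_(m + 1) * R) : pairing h.1 (row_mx a t%:M) =
      pairing (lsubmx h.1) a + rsubmx h.1 0 0 * t.
    rewrite -{1}[h.1]hsubmxK pairing_row_mx; congr (_ + _).
    by rewrite /pairing big_ord1 !mxE eqxx mulr1n.
  split=> ht h => [hs|/mapP[g gs ->] /=].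
    by rewrite e; apply: (ht (_, _, h.2)); apply/mapP; exists h.
  by rewrite -e; apply: ht.
have e2 (h : 'rV[R]_m * 'rV[R]_n.+1 * R) (t : R) (y : 'rV[R]_n) :
   pairing (row_mx h.1.1 (lsubmx (h.1.2 : 'rV_(1 + n)))) (row_mx a t%:M) +
   pairing (rsubmx (h.1.2 : 'rV_(1 + n))) y =
   pairing h.1.1 a + pairing h.1.2 (row_mx t%:M y : 'rV_(1 + n)).
  rewrite -[X in _ = _ + pairing X _](@hsubmxK _ 1 1 n).
  by rewrite (@pairing_row_mx 1 n) pairing_row_mx addrA.
split=> [[x hx]|[t]].
  exists ((x : 'rV_(1 + n)) 0 0); apply/key/hs2.
  exists (rsubmx (x : 'rV_(1 + n))) => _ /mapP[h /hx hh ->] /=.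
  rewrite e2; congr (_ + pairing _ _ <= _): hh.
  transitivity (row_mx (lsubmx (x : 'rV_(1 + n))) (rsubmx (x : 'rV_(1 + n)))).
    by rewrite hsubmxK.
  congr (row_mx _ _ : 'rV_(1 + n)).
  apply/rowP => i; rewrite ord1 !mxE eqxx mulr1n; congr (x _ _).
  exact: val_inj.
move=> /key/hs2[y hy]; exists (row_mx t%:M y : 'rV_(1 + n)) => h hs.
by rewrite -e2; apply: (hy (_, _, _)); apply/mapP; exists h.
Qed.

(** Take a simplex of the largest dimension contained in [A]. By convexity a homothety of small
    ratio centred at [x] carries it into [A], arbitrarily close to [x]. *)
Lemma convex_pure_dimensional m (A : set 'rV[R]_m) : A !=set0 ->
  (forall x y t, A x -> A y -> 0 <= t <= 1 -> A (x + t *: (y - x))) ->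
  pure_dimensional A.
Proof.
move=> [a0 Aa0] cA.
pose Q d := `[< has_simplex d A >].
have Q0 : exists d, Q d.
  exists 0%N; apply/asboolP; exists (fun=> a0); split.
    by rewrite /row_free flatmx0 mxrank0.
  by move=> w _; rewrite big_ord1 => e; rewrite big_ord1 e scale1r.
have Qm d : Q d -> (d <= m)%N.
  move=> /asboolP[v [/eqP e _]].
  by rewrite -[leqLHS]e rank_leq_col.
case: (ex_maxnP Q0 Qm) => d /asboolP[v [vfree vA]] dmax.
exists d; split.
  by move=> hd; have /dmax := asboolT hd; rewrite ltnn.
move=> x Ax U xU.
have shrink : \forall e \near (0 : R)^'+,
    forall (w : 'I_d.+1 -> R), (forall i, 0 <= w i) -> \sum_i w i = 1 ->
    U (x + e *: (\sum_i w i *: v i - x)).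
  move/nbhs_ballP: xU => [r r0 xrU].
  pose K := \sum_i `|v i - x|.
  have K0 : 0 <= K by apply: sumr_ge0.
  near=> e => w w0 w1; apply: xrU.
  have e0 : 0 < e by near: e; exact: nbhs_right_gt.
  (* [K] may vanish; adding 1 gives a positive divisor. *)
  have Kp : 0 < K + 1 by lra.
  rewrite -ball_normE /=.
  rewrite opprD addrA subrr add0r normrN normrZ gtr0_norm //.
  have -> : \sum_i w i *: v i - x = \sum_i w i *: (v i - x).
    under [RHS]eq_bigr do rewrite scalerBr.
    by rewrite sumrB -scaler_suml w1 scale1r.
  have wK : `|\sum_i w i *: (v i - x)| <= K.
    apply: le_trans (ler_norm_sum _ _ _) _; apply: ler_sum => i _.
    rewrite normrZ ger0_norm // ler_piMl //.
    by rewrite -w1 (bigD1 i) //= lerDl sumr_ge0.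
  apply: (@le_lt_trans _ _ (e * (K + 1))).
    by rewrite ler_pM2l //; lra.
  rewrite -ltr_pdivlMr //.
  near: e; apply: nbhs_right_lt; apply: divr_gt0; [exact: r0|lra].
have [e [e0 e1 eU]] : exists e : R, [/\ 0 < e, e <= 1 &
    forall (w : 'I_d.+1 -> R), (forall i, 0 <= w i) -> \sum_i w i = 1 ->
    U (x + e *: (\sum_i w i *: v i - x))].
  near (0 : R)^'+ => e; exists e; split.
  - by near: e; exact: nbhs_right_gt.
  - by near: e; exact: nbhs_right_le.
  - by near: e; exact: shrink.
exists (fun i => x + e *: (v i - x)); split.
  have -> : \matrix_(i < d) (x + e *: (v (lift ord0 i) - x) -
      (x + e *: (v ord0 - x))) = e *: \matrix_(i < d) (v (lift ord0 i) - v ord0).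
    apply/row_matrixP => i; rewrite rowK !linearZ /= rowK.
    rewrite opprD addrACA subrr add0r -scalerBr opprB addrA subrK //.
  by rewrite /row_free mxrank_scale_nz // gt_eqF.
move=> w w0 w1.
have -> : \sum_i w i *: (x + e *: (v i - x)) =
    x + e *: (\sum_i w i *: v i - x).
  rewrite (eq_bigr (fun i => w i *: x + e *: (w i *: v i - w i *: x))).
    rewrite big_split /= -scaler_sumr sumrB -scaler_suml w1 scale1r //.
  by move=> i _; rewrite scalerDr -scalerBr !scalerA mulrC.
split; last exact: eU.
by apply: cA => //; [exact: vA | rewrite (ltW e0)].
Unshelve. all: by end_near.
Qed.

End LinearSystems.

(** * Convexity of regular functions *)

Section Norms.
Context {R : realType}.

Lemma rV_norm_leP n (x : 'rV[R]_n) c : 0 <= c ->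
  (forall i, `|x 0 i| <= c) -> `|x| <= c.
Proof.
move=> c0 h; rewrite [leLHS]/Num.norm /= mx_normrE; apply/bigmax_leP; split=> //.
by move=> [i j] _ /=; rewrite ord1.
Qed.

Lemma rV_norm_ge_coord n (x : 'rV[R]_n) i : `|x 0 i| <= `|x|.
Proof.
rewrite [leRHS]/Num.norm /= mx_normrE; apply/bigmax_geP; right => /=.
by exists (0, i).
Qed.

Lemma pairing_norm_le n (a x : 'rV[R]_n) : `|pairing a x| <= n%:R * `|a| * `|x|.
Proof.
apply: le_trans (ler_norm_sum _ _ _) _.
have -> : n%:R * `|a| * `|x| = \sum_(i < n) `|a| * `|x|.
  by rewrite sumr_const card_ord -mulrA mulr_natl.
by apply: ler_sum => i _; rewrite normrM ler_pM ?rV_norm_ge_coord.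
Qed.

Lemma pairing_ge_norm n (x : 'rV[R]_n) : `|x| ^+ 2 <= pairing x x.
Proof.
have p0 : 0 <= pairing x x by apply: sumr_ge0 => i _; rewrite -expr2 sqr_ge0.
rewrite -[leRHS]sqr_sqrtr // ler_sqr ?nnegrE ?sqrtr_ge0 //.
apply: rV_norm_leP => [|i]; first exact: sqrtr_ge0.
rewrite -sqrtr_sqr ler_sqrt // /pairing (bigD1 i) //= -expr2 lerDl.
by apply: sumr_ge0 => j _; rewrite -expr2 sqr_ge0.
Qed.

Lemma mulmx_norm_le m n (A : 'M[R]_(m, n)) :
  exists2 C, 0 <= C & forall x : 'rV[R]_m, `|x *m A| <= C * `|x|.
Proof.
exists (m%:R * \sum_j `|(col j A)^T|) => [|x].
  by rewrite mulr_ge0 // sumr_ge0.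
apply: rV_norm_leP => [|j]; first by rewrite !mulr_ge0 // sumr_ge0.
have -> : (x *m A) 0 j = pairing (col j A)^T x.
  by rewrite pairingC mxE; apply: eq_bigr => i _; rewrite !mxE.
apply: le_trans (pairing_norm_le _ _) _; rewrite ler_wpM2r // ler_wpM2l //.
by rewrite (bigD1 j) //= lerDl sumr_ge0.
Qed.

Lemma closed_ball_compact n r : compact [set x : 'rV[R]_n | `|x| <= r].
Proof.
apply: bounded_closed_compact.
  exists r; split=> [|M rM x /= xr]; first exact: num_real.
  exact: le_trans xr (ltW rM).
apply: (@preimage_closed _ _ (fun x : 'rV[R]_n => `|x|) [set t | t <= r]).
  by move=> x _; exact: norm_continuous.
exact: closed_le.
Qed.

Lemma near_norm_le n (x0 : 'rV[R]_n) : \forall x \near x0, `|x| <= `|x0| + 1.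
Proof.
apply/nbhs_ballP; exists 1 => //= x; rewrite -ball_normE /= => h.
by rewrite -lerBlDl (le_trans (lerB_dist _ _)) // distrC ltW.
Qed.

(** The entries of such vectors lie strictly between [- N] and [N]; shifting by [N] indexes them by
    ordinals. *)
Lemma finite_integral n W : exists s : seq 'rV[R]_n,
  forall m, integral m -> `|m| <= W -> m \in s.
Proof.
pose N := (Num.truncn W).+1.
exists [seq map_mx (fun k : 'I_(N + N) => k%:R - N%:R) v | v : 'rV['I_(N + N)]_n].
move=> m /mxOverP mint mW.
have key i : exists k : 'I_(N + N), m 0 i = k%:R - N%:R.
  have /intrP[z mz] := mint 0 i.
  have : `|m 0 i| < N%:R.
    apply: le_lt_trans (rV_norm_ge_coord _ _) (le_lt_trans mW _).
    exact: truncnS_gt.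
  rewrite mz -intr_norm -[N%:R]/(N%:~R : R) ltr_int => hz.
  have zN : (absz (z + N%:Z)%R < N + N)%N by lia.
  exists (Ordinal zN); rewrite /= !pmulrn -intrB.
  by congr (_%:~R); lia.
apply/mapP; exists (\row_i sval (cid (key i))); first by rewrite mem_enum.
by apply/rowP => i; rewrite !mxE; case: cid => k.
Qed.

End Norms.

Section Convexity.
Context {R : realType}.

(* Adding the strictly convex [e (t^2 - t)] makes an interior maximum
   incompatible with a local support line. *)
Lemma locally_supported_chord (u : R -> R) : continuous u ->
  (forall t0, exists s, \forall t \near t0, u t0 + s * (t - t0) <= u t) ->
  forall t, 0 <= t <= 1 -> u t <= (1 - t) * u 0 + t * u 1.
Proof.
move=> uc usup t t01; apply/ler_addgt0Pr => e e0.
pose w t := u t - ((1 - t) * u 0 + t * u 1) + e * (t ^+ 2 - t).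
have wc : continuous w.
  move=> x; apply: cvgD.
    apply: cvgB; first exact: uc.
    apply: cvgD; apply: cvgM; try exact: cvg_cst; try exact: cvg_id.
    by apply: cvgB; [exact: cvg_cst|exact: cvg_id].
  apply: cvgM; first exact: cvg_cst.
  by apply: cvgB; [exact: (@exprn_continuous _ 2)|exact: cvg_id].
have [t1 t1in tmax] := @EVT_max R w 0 1 ler01 (continuous_subspaceT wc).
suff w1 : w t1 <= 0.
  have := tmax t; rewrite in_itv /= => /(_ t01) wt.
  have : w t <= 0 by exact: le_trans wt w1.
  rewrite /w => ?; nra.
have [->|t1n0] := eqVneq t1 0; first by rewrite /w; nra.
have [->|t1n1] := eqVneq t1 1; first by rewrite /w; nra.
move: t1in; rewrite in_itv /= => /andP[t10 t11].
have {}t10 : 0 < t1 by rewrite lt_neqAle eq_sym t1n0.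
have {}t11 : t1 < 1 by rewrite lt_neqAle t1n1.
have [s /nbhs_ballP[d d0 hs]] := usup t1.
have d0' : 0 < d := d0.
pose r := Num.min (d / 2) (Num.min t1 (1 - t1)).
have r0 : 0 < r by rewrite /r !lt_min divr_gt0 // t10 subr_gt0.
have rd : r <= d / 2 by rewrite /r ge_min lexx.
have rt : r <= t1 by rewrite /r !ge_min lexx orbT.
have rt' : r <= 1 - t1 by rewrite /r !ge_min lexx !orbT.
have h1 : u t1 + s * (t1 + r - t1) <= u (t1 + r).
  by apply: hs; rewrite /ball /= ltr_norml; apply/andP; split; lra.
have h2 : u t1 + s * (t1 - r - t1) <= u (t1 - r).
  by apply: hs; rewrite /ball /= ltr_norml; apply/andP; split; lra.
have := tmax (t1 + r); have := tmax (t1 - r); rewrite !in_itv /= /w => g1 g2.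
have {}g1 := g1 ltac:(apply/andP; split; lra).
have {}g2 := g2 ltac:(apply/andP; split; lra).
have : 0 < e * r ^+ 2 by rewrite mulr_gt0 // exprn_gt0.
nra.
Qed.

Lemma quadratic_nonneg (a b c : R) :
  (forall t, 0 <= a * t ^+ 2 + b * t + c) -> 0 <= a /\ (a = 0 -> b = 0).
Proof.
move=> h; split=> [|a0].
  rewrite leNgt; apply/negP => a0.
  (* This [T] makes [a * T + b] less than [-1] minus the absolute value of [c]; since [T >= 1], the
     polynomial is negative at [T]. *)
  pose T := (`|b| + `|c| + 1) / - a + 1.
  have e : a * T = - (`|b| + `|c| + 1) + a by rewrite /T; field; lra.
  have T1 : 1 <= T by rewrite lerDr divr_ge0 ?addr_ge0 //; lra.
  have := h T; have := ler_norm b; have := ler_norm c.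
  have := normr_ge0 c; have := normr_ge0 b.
  move: (`|b|) (`|c|) e => B C e *; nra.
apply/eqP/negPn/negP => b0.
(* At this point the linear polynomial takes the value [-1]. *)
have := h (- (c + 1) / b); rewrite a0 mul0r add0r mulrC divfK //; lra.
Qed.

Context {n : nat}.
Local Notation V := 'rV[R]_n.

Lemma bigmax_affine_ge (p : V * R) s x p' : p' \in p :: s ->
  affine_eval p' x <= \big[Num.max/affine_eval p x]_(q <- s) affine_eval q x.
Proof.
rewrite inE => /predU1P[->|ps]; first exact: bigmax_ge_id.
elim: s ps => // q s IH; rewrite big_cons le_max inE => /predU1P[->|/IH->].
  by rewrite lexx.
by rewrite orbT.
Qed.

Lemma bigmax_affine_attained (p : V * R) s x : exists2 p', p' \in p :: s &
  \big[Num.max/affine_eval p x]_(q <- s) affine_eval q x = affine_eval p' x.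
Proof.
elim: s => [|q s [p' p's e]]; first by exists p; rewrite ?mem_head ?big_nil.
rewrite big_cons e; have [_|_] := leP (affine_eval q x) (affine_eval p' x).
  by exists p' => //; move: p's; rewrite !inE => /orP[->|->]; rewrite ?orbT.
by exists q => //; rewrite !inE eqxx orbT.
Qed.

Lemma affine_eval_continuous (p : V * R) : continuous (affine_eval p).
Proof.
move=> x; rewrite /affine_eval.
exact: (@cvgD _ R^o _ _ _ (pairing p.1) (cst p.2) _ _
  (@pairing_continuous _ _ p.1 x) (cvg_cst _)).
Qed.

(** Domination and attainment are easier to check for maxima and twists than an iterated maximum
    with a distinguished first element; continuity follows from the local formula. *)
Lemma regularP (f : V -> R) :
  (forall x0 : V, exists2 s : seq (V * R), {in s, forall p, integral p.1} &
     \forall x \near x0, {in s, forall p, affine_eval p x <= f x} /\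
       exists2 p, p \in s & f x = affine_eval p x) ->
  regular f.
Proof.
move=> h.
have h' (x0 : V) : exists (p : V * R) (s : seq (V * R)),
    {in p :: s, forall p', integral p'.1} /\
    \forall x \near x0,
      f x = \big[Num.max/affine_eval p x]_(p' <- s) affine_eval p' x.
  have [[|p s] sint nearf] := h x0.
    by have [_ []] := nbhs_singleton nearf.
  exists p, s; split=> //; apply: filterS nearf => x [le [q qs e]].
  have [q' q's e'] := bigmax_affine_attained p s x.
  apply/eqP; rewrite eq_le {1}e bigmax_affine_ge //= e'; exact: le.
split=> // x0; have [p [s [_ nearf]]] := h' x0.
have bc : continuous
    (fun x => \big[Num.max/affine_eval p x]_(p' <- s) affine_eval p' x).
  elim: s {nearf} => [|q s IH].
    by under eq_fun do rewrite big_nil; exact: affine_eval_continuous.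
  under eq_fun do rewrite big_cons.
  by move=> x; apply: continuous_max; [exact: affine_eval_continuous|exact: IH].
rewrite /continuous_at (nbhs_singleton nearf).
apply: cvg_trans (@near_eq_cvg _ _ (nbhs x0) _ _ _ _) (bc x0).
by apply: filterS nearf => x ->.
Qed.

Lemma regular_local_support (f : V -> R) : regular f ->
  forall x0 : V, exists p : V * R, [/\ integral p.1, affine_eval p x0 = f x0 &
    \forall x \near x0, affine_eval p x <= f x].
Proof.
move=> [_ h] x0; have [p [s [sint nearf]]] := h x0.
have [p' p's e] := bigmax_affine_attained p s x0.
exists p'; split; first exact: sint.
  by rewrite (nbhs_singleton nearf).
by apply: filterS nearf => x ->; exact: bigmax_affine_ge.
Qed.

(** A local support is global by convexity: on the segment from [x0] to [x], [f] lies below its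
    chord and, at some small [t > 0], above the support; dividing by [t] gives the inequality at
    [x]. *)
Lemma regular_support (f : V -> R) : regular f ->
  forall x0 : V, exists2 m, integral m &
    forall x, f x0 + pairing m (x - x0) <= f x.
Proof.
move=> freg x0; have [p [pint px0 pf]] := regular_local_support freg x0.
exists p.1 => // x; have [fc _] := freg.
pose g t : V := x0 + t *: (x - x0).
have gc : continuous g.
  move=> t; apply: cvgD; first exact: cvg_cst.
  by apply: cvgZl; exact: cvg_id.
have pg q t : affine_eval q (g t) = affine_eval q x0 + t * pairing q.1 (x - x0).
  by rewrite /affine_eval /g pairingDr pairingZr; ring.
have g0 : g 0 = x0 by rewrite /g scale0r addr0.
have g1 : g 1 = x by rewrite /g scale1r addrC subrK.
have fgc : continuous (f \o g).
  by move=> t; apply: continuous_comp; [exact: gc|exact: fc].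
have chord := @locally_supported_chord (f \o g) fgc.
have {}chord t : 0 <= t <= 1 -> f (g t) <= (1 - t) * f x0 + t * f x.
  move: t; rewrite -[in f x0]g0 -[in f x]g1; apply: chord => t0.
  have [q [_ qe qf]] := regular_local_support freg (g t0).
  exists (pairing q.1 (x - x0)).
  have near_t0 : nbhs t0 (g @^-1` [set y | affine_eval q y <= f y]).
    exact: gc t0 _ qf.
  apply: filterS near_t0 => t1 /=.
  by rewrite -qe !pg; lra.
have [t [t0 t1]] : exists t, [/\ 0 < t, t <= 1 & affine_eval p (g t) <= f (g t)].
  rewrite -g0 in pf.
  near (0 : R)^'+ => t; exists t; split.
  - by near: t; exact: nbhs_right_gt.
  - by near: t; exact: nbhs_right_le.
  - near: t; apply: cvg_within; exact: (gc 0 _ pf).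
rewrite pg px0 => h.
have := chord t; rewrite (ltW t0) t1 => /(_ isT) h2.
have : t * (f x0 + pairing p.1 (x - x0)) <= t * f x by nra.
by rewrite ler_pM2l.
Unshelve. all: by end_near.
Qed.

End Convexity.

(** * Quadratic forms and lattices *)

Section QuadraticForm.
Context {R : realType} {n : nat} (S : 'M[R]_n).
Implicit Types (x y z u v w : 'rV[R]_n).

Lemma QRE x y : QR S x y = pairing (x *m S) y.
Proof. by rewrite pairingE. Qed.

Lemma QRDl x y z : QR S (x + y) z = QR S x z + QR S y z.
Proof. by rewrite !QRE mulmxDl pairingDl. Qed.

Lemma QRZl t x y : QR S (t *: x) y = t * QR S x y.
Proof. by rewrite !QRE -scalemxAl pairingZl. Qed.

Lemma QRNl x y : QR S (- x) y = - QR S x y.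
Proof. by rewrite !QRE mulNmx pairingNl. Qed.

Lemma QRDr x y z : QR S x (y + z) = QR S x y + QR S x z.
Proof. by rewrite !QRE pairingDr. Qed.

Lemma QRZr t x y : QR S x (t *: y) = t * QR S x y.
Proof. by rewrite !QRE pairingZr. Qed.

Lemma QRNr x y : QR S x (- y) = - QR S x y.
Proof. by rewrite !QRE pairingNr. Qed.

Definition QR_linear := (QRDl, QRDr, QRNl, QRNr, QRZl, QRZr).

Lemma QR_continuous : continuous (fun x => QR S x x).
Proof.
have -> : (fun x => QR S x x) =
    (fun x : 'rV[R]_n => \sum_i pairing (col i S)^T x * x 0 i).
  apply/funext => x; rewrite QRE; apply: eq_bigr => i _; congr (_ * _).
  by rewrite pairingC mxE; apply: eq_bigr => j _; rewrite !mxE.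
apply: (@continuous_big R^o 'I_n +%R 0 predT _ 'rV[R]_n) => [|i _ x].
  exact: (@add_continuous R^o).
exact: (@cvgM R _ (nbhs x) _ (pairing (col i S)^T) (fun x : 'rV_n => x 0 i)
  _ _ (@pairing_continuous _ _ _ x) (@coord_continuous _ _ _ _ _ x)).
Qed.

(** The pseudo-inverse selects a preimage of controlled size, so a point with bounded image can be
    made bounded modulo the kernel of [S]. *)
Lemma bounded_preimage : exists2 C, 0 <= C &
  forall x, exists2 x', x' *m S = x *m S & `|x'| <= C * `|x *m S|.
Proof.
have [C C0 hC] := mulmx_norm_le (pinvmx S); exists C => // x.
by exists (x *m S *m pinvmx S); [rewrite mulmxKpV // submxMl|exact: hC].
Qed.

Context (symS : forall x y, QR S x y = QR S y x).

Lemma QR_sym_trmx : S^T = S.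
Proof.
apply/matrixP => i j; have := symS (delta_mx 0 j) (delta_mx 0 i).
by rewrite /QR !trmx_delta -!rowE -!colE !mxE.
Qed.

Lemma QR_eq_image x y : x *m S = y *m S -> QR S x x = QR S y y.
Proof. by move=> e; rewrite QRE e -QRE symS QRE e -QRE. Qed.

(** As [S] is symmetric, the transposed columns of its cokernel matrix lie in its kernel. Hence
    [w *m cokermx S = 0], which characterizes the row space. *)
Lemma kernel_orthogonal_range w :
  (forall v, v *m S = 0 -> pairing w v = 0) -> exists y, w = y *m S.
Proof.
move=> h; suff /submxP[y ->] : (w <= S)%MS by exists y.
rewrite submxE; apply/eqP/rowP => j; rewrite !mxE.
have := h (col j (cokermx S))^T; rewrite /pairing => e.
rewrite -[RHS]e; first by apply: eq_bigr => i _; rewrite !mxE.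
rewrite -[X in _^T *m X]QR_sym_trmx -trmx_mul colE mulmxA mulmx_coker.
by rewrite mul0mx trmx0.
Qed.

(** Semidefiniteness is applied to [u - D^-1 *: w] with [w = u *m S]. The cross terms contribute
    [- 2 * D^-1 * pairing w w], and [D] is chosen so that the term quadratic in [w] cancels at most
    half of this. *)
Lemma QR_coercive : (forall x, 0 <= QR S x x) ->
  exists2 D, 0 < D & forall u, `|u *m S| ^+ 2 <= D * QR S u u.
Proof.
move=> psd; have [C C0 hC] := mulmx_norm_le S.
pose D := n%:R * C + 1; have D0 : 0 < D by rewrite ltr_wpDl // mulr_ge0.
exists D => // u; apply: le_trans (pairing_ge_norm _) _.
set w := u *m S; have := psd (u - D^-1 *: w); rewrite !QR_linear (symS w u).
have -> : QR S u w = pairing w w by rewrite QRE.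
have wD : QR S w w <= D * pairing w w.
  rewrite QRE; apply: le_trans (ler_norm _) _.
  apply: le_trans (pairing_norm_le _ _) _.
  have := hC w; have := pairing_ge_norm w; have := normr_ge0 w.
  have n0 : 0 <= n%:R :> R by [].
  move: (`|w|) (`|w *m S|) (n%:R) n0 @D D0 => a b m m0 D D0 a0 ha hb.
  rewrite /D; apply: (@le_trans _ _ (m * (C * a) * a)).
    by rewrite ler_wpM2r // ler_wpM2l.
  have : m * C * a ^+ 2 <= m * C * pairing w w by rewrite ler_wpM2l // mulr_ge0.
  have : 0 <= pairing w w by apply: le_trans ha; rewrite sqr_ge0.
  lra.
move: (QR S u u) (QR S w w) (pairing w w) wD => p q s wD.
have Di : 0 < D^-1 by rewrite invr_gt0.
have : D^-1 * (D^-1 * q) <= D^-1 * s.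
  by rewrite ler_wpM2l ?(ltW Di) // ler_pdivrMl.
by move=> ? ?; rewrite -ler_pdivrMl //; lra.
Qed.

End QuadraticForm.

Lemma seq_argmax (R : realType) (T : eqType) (g : T -> R) (x0 : T) (s : seq T) :
  x0 \in s -> exists2 l, l \in s & forall l', l' \in s -> g l' <= g l.
Proof.
elim: s x0 => // l [|l1 s] IH _ _.
  by exists l => [|l']; rewrite ?mem_head // inE => /eqP->.
have [l' l's hl'] := IH l1 (mem_head _ _).
have [h|h] := leP (g l) (g l').
  exists l' => [|l2]; first by rewrite inE l's orbT.
  by rewrite inE => /predU1P[->//|/hl'].
exists l => [|l2]; first by rewrite mem_head.
by rewrite inE => /predU1P[->//|/hl' /le_trans]; apply; exact: ltW.
Qed.

(** * Lattices and periodic functions *)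

Section Lattice.
Context {R : realType} {n : nat} (Lam : set 'rV[R]_n) (hLam : is_lattice Lam).
Local Notation V := 'rV[R]_n.

Lemma intvec0 : integral (0 : V).
Proof. by apply/mxOverP => i j; rewrite mxE rpred0. Qed.

Lemma intvecD (a b : V) : integral a -> integral b -> integral (a + b).
Proof.
by move=> /mxOverP ha /mxOverP hb; apply/mxOverP => i j; rewrite mxE rpredD.
Qed.

Lemma intvecN (a : V) : integral a -> integral (- a).
Proof. by move=> /mxOverP ha; apply/mxOverP => i j; rewrite mxE rpredN. Qed.

Lemma intvecB (a b : V) : integral a -> integral b -> integral (a - b).
Proof. by move=> ha hb; apply: intvecD => //; exact: intvecN. Qed.

Lemma lattice0 : Lam 0.
Proof.
by have [M _ ->] := hLam; exists 0; [exact: intvec0|rewrite mul0mx].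
Qed.

Lemma latticeD x y : Lam x -> Lam y -> Lam (x + y).
Proof.
have [M _ ->] := hLam => -[a ha <-] [b hb <-].
by exists (a + b); [exact: intvecD|rewrite mulmxDl].
Qed.

Lemma latticeN x : Lam x -> Lam (- x).
Proof.
have [M _ ->] := hLam => -[a ha <-].
by exists (- a); [exact: intvecN|rewrite mulNmx].
Qed.

Lemma latticeB x y : Lam x -> Lam y -> Lam (x - y).
Proof. by move=> ? ?; apply: latticeD => //; exact: latticeN. Qed.

(** Rounding down the coordinates in a lattice basis leaves a remainder with coordinates in
    [[0, 1)]. *)
Lemma lattice_cobounded : exists rho : R,
  forall x, exists2 l, Lam l & `|x - l| <= rho.
Proof.
have [M Mu LE] := hLam; have [C C0 hC] := mulmx_norm_le M.
exists C => x; pose y := x *m invmx M.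
pose z := map_mx (fun t : R => (Num.floor t)%:~R : R) y.
exists (z *m M).
  by rewrite LE; exists z => //; apply/mxOverP => i j; rewrite mxE intr_int.
have {1}-> : x = y *m M by rewrite mulmxKV.
rewrite -mulmxBl; apply: le_trans (hC _) _; rewrite ler_piMr //.
apply: rV_norm_leP => // i; rewrite /z; move: y {z} => y; rewrite !mxE.
have := floor_le_tmp (y 0 i); have := floorD1_gt (y 0 i).
by rewrite intrD1 ler_norml => *; apply/andP; split; lra.
Qed.

(** A ball of radius [rho] meets every class modulo [Lam], so the minimum on this compact set is
    global. *)
Lemma periodic_min (h : V -> R) : continuous h ->
  (forall x l, Lam l -> h (x + l) = h x) -> exists x0, forall x, h x0 <= h x.
Proof.
move=> hc hper; have [rho hrho] := lattice_cobounded.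
have [l0 _ rho0] := hrho 0.
have [||x0 _ x0min] :=
    @EVT_min_rV R n h [set x | `|x| <= rho] _ (@closed_ball_compact _ _ _) _.
- by exists (0 - l0).
- exact: continuous_subspaceT.
exists x0 => x; have [l Ll xl] := hrho x.
rewrite -[x](subrK l) hper //; apply: x0min; exact/mem_set.
Qed.

(** The list [s] is a lattice basis, the rows of [M]; the pairings with it are the entries of
    [M *m y^T], from which [invmx M] recovers [y]. *)
Lemma lattice_basis_bound : exists (s : seq V) (C : R),
  [/\ {in s, forall l, Lam l}, 0 <= C &
     forall y K, 0 <= K -> {in s, forall l, `|pairing l y| <= K} ->
       `|y| <= C * K].
Proof.
have [M Mu LE] := hLam; have [C C0 hC] := mulmx_norm_le (invmx M)^T.
exists [seq row i M | i <- enum 'I_n], C; split=> // [_ /mapP[i _ ->]|y K K0 hy].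
  rewrite LE; exists (delta_mx 0 i); last by rewrite -rowE.
  apply/mxOverP => a b; rewrite mxE; exact: rpred_nat.
have -> : y = (M *m y^T)^T *m (invmx M)^T by rewrite -trmx_mul mulKmx // trmxK.
apply: le_trans (hC _) _; rewrite ler_wpM2l //.
apply: rV_norm_leP => // i; have -> : (M *m y^T)^T 0 i = pairing (row i M) y.
  by rewrite !mxE; apply: eq_bigr => j _; rewrite !mxE.
by apply: hy; apply/mapP; exists i => //; rewrite mem_enum.
Qed.

End Lattice.

(** * Theta functions *)

Section ThetaFunction.
Context {R : realType} {n : nat} (Lam : set 'rV[R]_n) (S : 'M[R]_n).
Context (hLam : is_lattice Lam) (hS : is_polarization Lam S).
Local Notation V := 'rV[R]_n.

Lemma polarization_sym x y : QR S x y = QR S y x.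
Proof. by case: hS. Qed.

Lemma qR_integral l : Lam l -> integral (qR S l).
Proof.
move=> Ll.
suff h j : qR S l 0 j \is a Num.int by apply/mxOverP => i j; rewrite ord1.
have dint : integral (delta_mx 0 j : V).
  by apply/mxOverP => a b; rewrite mxE; exact: rpred_nat.
have [_ /(_ l _ Ll dint)] := hS.
by rewrite /QR trmx_delta -colE [col _ _ _ _]mxE.
Qed.

(** * Growth and supports of theta functions *)

Section Growth.
Context (alpha : V) (f : V -> R) (fth : is_theta Lam S alpha f).

(* [f - Q / 2 - alpha] is periodic. *)
Lemma theta_growth : exists C, forall x,
  f x <= 2^-1 * QR S x x + pairing alpha x + C.
Proof.
have [[fc _] fq] := fth.
pose h x := 2^-1 * QR S x x + pairing alpha x - f x.
have hc : continuous h.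
  move=> x.
  have h1 := cvgM (cvg_cst (2^-1 : R)) (@QR_continuous _ _ S x).
  have h2 := cvgD (h1 _ _) (@pairing_continuous _ _ alpha x).
  exact: (cvgB (h2 _ _ _) (fc x)).
have [|x0 hx0] := periodic_min hLam hc.
  move=> x l Ll; rewrite /h fq // !QR_linear (polarization_sym x l) pairingDr.
  lra.
by exists (- h x0) => x; have := hx0 x; rewrite {2}/h; lra.
Qed.

(** Along the line [t *: v] the support stays below the bound of [theta_growth]; the difference is a
    nonnegative polynomial in [t] with leading coefficient [2^-1 * QR S v v]. *)
Lemma theta_support_quadratic m x0 v :
  (forall x, f x0 + pairing m (x - x0) <= f x) ->
  0 <= QR S v v /\ (QR S v v = 0 -> pairing (m - alpha) v = 0).
Proof.
move=> hm; have [C hC] := theta_growth.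
have [t|q0 q1] := @quadratic_nonneg _ (2^-1 * QR S v v) (pairing (alpha - m) v)
    (C + pairing m x0 - f x0).
  have := le_trans (hm (t *: v)) (hC _).
  rewrite !QR_linear pairingBl pairingBr !pairingZr.
  by move=> ?; nra.
split=> [|q]; first lra.
by have := q1; rewrite q mulr0 !pairingBl => /(_ erefl); lra.
Qed.

Lemma theta_psd x : 0 <= QR S x x.
Proof.
have [m _ hm] := regular_support fth.1 0.
by have [] := theta_support_quadratic x hm.
Qed.

Lemma theta_support_range m x0 :
  (forall x, f x0 + pairing m (x - x0) <= f x) ->
  exists y, m - alpha = y *m S.
Proof.
move=> hm; apply: (kernel_orthogonal_range polarization_sym) => v v0.
have [_ ->] := theta_support_quadratic v hm => //.
by rewrite QRE v0 pairing0l.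
Qed.

End Growth.

(** * The basic theta functions as locally finite maxima *)

Section ThetaTerm.
Context (psd : forall x, 0 <= QR S x x).
Context (r b c : V) (bint : integral b) (cb : qR S c = b).
Local Notation term := (theta_term S r b c).

(** As [b = qR S c], translating the argument by [l'] only shifts the index in the completed square
    and adds the factor of automorphy. *)
Lemma theta_term_shift l l' x : term l (x + l') =
  term (l - l') x + QR S l' x + 2^-1 * QR S l' l' + QR S r l'.
Proof.
rewrite /theta_term -cb /qR mulmxBl !(pairingDl, pairingNl, pairingDr) -!QRE.
rewrite !QR_linear (polarization_sym c l) (polarization_sym r l).
rewrite (polarization_sym r c) (polarization_sym l' l).
rewrite (polarization_sym l' c) (polarization_sym l' r).
lra.
Qed.

(** If the term of index [l] exceeds that of index [0] on the ball, coercivity gives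
    [t ^+ 2 < A * t + E] for the norm [t] of [(l + c - r) *m S]. This bounds the integral slope
    [b + l *m S], leaving finitely many slopes. Terms of equal slope coincide, because [QR S u u]
    depends only on [u *m S]. *)
Lemma theta_term_finite rho : exists F : seq V,
  {in F, forall l, Lam l} /\
  forall x, `|x| <= rho -> forall l, Lam l ->
    exists2 l', l' \in F & term l x <= term l' x.
Proof.
have [D D0 hD] := QR_coercive polarization_sym psd.
pose K := n%:R * `|b| * rho + 2^-1 * QR S (c - r) (c - r).
pose A := 2 * D * (n%:R * rho); pose E := 2 * D * (n%:R * `|r *m S| * rho + K).
pose W := A + E + 1 + `|r *m S|.
have [s hs] := @finite_integral R n W.
(* One lattice index per slope; the default [0] stays in [Lam] when no index has slope [m]. *)
pose pre m := xget 0 [set l | Lam l /\ b + l *m S = m].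
exists (0 :: [seq pre m | m <- s]); split.
  move=> l; rewrite inE => /predU1P[->|/mapP[m _ ->]]; first exact: lattice0.
  by rewrite /pre; case: xgetP => [l' _ []|_] //; exact: lattice0.
move=> x xrho l Ll; have rho0 : 0 <= rho by exact: le_trans xrho.
have [le0|lt0] := leP (term l x) (term 0 x).
  by exists 0; rewrite ?mem_head.
suff lW : `|b + l *m S| <= W.
  have bl : integral (b + l *m S) by apply: intvecD => //; exact: qR_integral.
  have [Lp pE] : [set l' | Lam l' /\ b + l' *m S = b + l *m S] (pre (b + l *m S)).
    by apply: xgetPex; exists l.
  exists (pre (b + l *m S)).
    by rewrite inE map_f ?orbT //; exact: hs.
  rewrite /theta_term /qR pE lerD2l lerN2 ler_wpM2l //.
  rewrite (@QR_eq_image _ _ S polarization_sym (pre _ + c - r) (l + c - r)) //.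
  have := pE; rewrite !mulmxBl !mulmxDl => /addrI -> //.
set w := (l + c - r) *m S.
have blE : b + l *m S = w + r *m S.
  by rewrite /w !mulmxBl mulmxDl -cb /qR subrK addrC.
have nn : 0 <= n%:R :> R by [].
have h0 : - K <= term 0 x.
  rewrite /theta_term /qR mul0mx add0r addr0.
  have := pairing_norm_le b x; rewrite ler_norml => /andP[h _].
  have : n%:R * `|b| * `|x| <= n%:R * `|b| * rho by rewrite ler_wpM2l ?mulr_ge0.
  by rewrite /K; lra.
have hl : term l x <=
    n%:R * (`|w| + `|r *m S|) * rho - 2^-1 * QR S (l + c - r) (l + c - r).
  rewrite /theta_term /qR blE lerD2r; apply: le_trans (ler_norm _) _.
  apply: le_trans (pairing_norm_le _ _) _.
  by rewrite ler_pM ?mulr_ge0 // ler_wpM2l // ler_normD.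
have hw := hD (l + c - r); rewrite -/w in hw.
rewrite blE; apply: le_trans (ler_normD _ _) _; rewrite /W lerD2r.
have K0 : 0 <= K by rewrite /K addr_ge0 // mulr_ge0 // mulr_ge0.
have A0 : 0 <= A by rewrite /A !mulr_ge0 // ltW.
have E0 : 0 <= E.
  by rewrite /E mulr_ge0 ?mulr_ge0 // ?(ltW D0) // addr_ge0 // !mulr_ge0.
have hAE : `|w| ^+ 2 < A * `|w| + E.
  have : 2^-1 * QR S (l + c - r) (l + c - r) <
      n%:R * (`|w| + `|r *m S|) * rho + K by lra.
  move: (QR S _ _) hw => q hw hq; rewrite /A /E.
  have : D * (2^-1 * q) < D * (n%:R * (`|w| + `|r *m S|) * rho + K).
    by rewrite ltr_pM2l.
  by lra.
rewrite leNgt; apply/negP => hlt; have := normr_ge0 w; nra.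
Qed.

Lemma Theta_max x : exists2 l, Lam l &
  Theta Lam S r b c x = (term l x)%:E /\
  forall l', Lam l' -> term l' x <= term l x.
Proof.
have [F [FL hF]] := theta_term_finite `|x|.
have [l0 l0F _] := hF x (lexx _) 0 (lattice0 hLam).
have [l lF lmax] : exists2 l, l \in F &
    forall l', l' \in F -> term l' x <= term l x.
  exact: (@seq_argmax _ _ (term^~ x) _ _ l0F).
have lmax' l' : Lam l' -> term l' x <= term l x.
  by move=> /(hF _ (lexx _))[l2 /lmax + h]; exact: le_trans.
exists l; first exact: FL.
split=> //; apply/eqP; rewrite eq_le; apply/andP; split.
  by apply: ge_ereal_sup => _ [l' Ll' <-]; rewrite lee_fin lmax'.
by apply: ereal_sup_ubound; exists l => //; exact: FL.
Qed.

Definition theta_fun x := fine (Theta Lam S r b c x).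

Lemma Theta_fin x : Theta Lam S r b c x = (theta_fun x)%:E.
Proof. by rewrite /theta_fun; have [l _ [-> _]] := Theta_max x. Qed.

Lemma theta_fun_ge l x : Lam l -> term l x <= theta_fun x.
Proof. by rewrite /theta_fun; have [l' _ [-> h]] := Theta_max x; exact: h. Qed.

Lemma theta_fun_attained x : exists2 l, Lam l & theta_fun x = term l x.
Proof. by rewrite /theta_fun; have [l Ll [-> _]] := Theta_max x; exists l. Qed.

Lemma theta_fun_finite rho : exists F : seq V, {in F, forall l, Lam l} /\
  forall x, `|x| <= rho -> exists2 l, l \in F & theta_fun x = term l x.
Proof.
have [F [FL hF]] := theta_term_finite rho; exists F; split=> // x xrho.
have [l Ll e] := theta_fun_attained x.
have [l' l'F hl'] := hF x xrho l Ll; exists l' => //.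
apply/eqP; rewrite eq_le {1}e hl' /=; apply: theta_fun_ge; exact: FL.
Qed.

(** By [theta_term_shift], translation by [l] permutes the terms up to a common factor of
    automorphy. *)
Lemma theta_fun_shift l x : Lam l -> theta_fun (x + l) =
  theta_fun x + QR S l x + 2^-1 * QR S l l + QR S r l.
Proof.
move=> Ll; apply/eqP; rewrite eq_le; apply/andP; split.
  have [l' Ll' ->] := theta_fun_attained (x + l).
  by rewrite theta_term_shift !lerD2r theta_fun_ge //; exact: latticeB.
have [l' Ll' ->] := theta_fun_attained x.
rewrite -[in term l' x](addrK l l') -theta_term_shift theta_fun_ge //.
exact: latticeD.
Qed.

Lemma theta_fun_locally_max (x0 : V) : exists2 s : seq (V * R),
  {in s, forall p, integral p.1} &
  \forall x \near x0, {in s, forall p, affine_eval p x <= theta_fun x} /\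
       exists2 p, p \in s & theta_fun x = affine_eval p x.
Proof.
have [F [FL hF]] := theta_fun_finite (`|x0| + 1).
exists [seq (b + qR S l, - (2^-1 * QR S (l + c - r) (l + c - r))) | l <- F].
  move=> _ /mapP[l lF ->] /=; apply: intvecD => //; exact/qR_integral/FL.
apply: filterS (near_norm_le x0) => x /hF[l lF e]; split=> [_ /mapP[l2 l2F ->]|].
  exact: theta_fun_ge (FL _ l2F).
exists (b + qR S l, - (2^-1 * QR S (l + c - r) (l + c - r))) => //.
by apply/mapP; exists l.
Qed.

Lemma theta_fun_continuous : continuous theta_fun.
Proof. by have [] := regularP theta_fun_locally_max. Qed.

End ThetaTerm.
End ThetaFunction.

(** * Coordinates of theta functions *)

(** Greedy choice: an element is added only if it is unrelated to those already chosen. *)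
Lemma transversal_seq (T : eqType) (E : T -> T -> Prop) (s : seq T) :
  (forall a, E a a) -> (forall a b, E a b -> E b a) ->
  exists t, [/\ uniq t, {subset t <= s},
    forall a, a \in s -> exists2 b, b \in t & E a b &
    forall a b, a \in t -> b \in t -> E a b -> a = b].
Proof.
move=> refl sym; elim: s => [|x s [t [ut ts cov inj]]]; first by exists [::].
have [[b bt xb]|nb] := pselect (exists2 b, b \in t & E x b).
  exists t; split=> // [a /ts as_|a].
    by rewrite inE as_ orbT.
  by rewrite inE => /predU1P[->|/cov//]; exists b.
have xt : x \notin t by apply/negP => xt; apply: nb; exists x.
exists (x :: t); split=> [|a|a|a b].
- by rewrite /= xt.
- by rewrite !inE => /predU1P[->|/ts->]; rewrite ?eqxx ?orbT.
- rewrite inE => /predU1P[->|/cov[b bt ab]]; first by exists x; rewrite ?mem_head.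
  by exists b; rewrite // inE bt orbT.
rewrite !inE => /predU1P[->|at_] /predU1P[->|bt] // ab; last exact: inj.
  by case: nb; exists b.
by case: nb; exists a => //; exact: sym.
Qed.

(** For [a = qR S y], subtracting [qR S l] with [l] a lattice point close to [y] moves each class
    into a bounded set, which has finitely many integral points; a transversal of these represents
    all classes. *)
Lemma representatives_exist (R : realType) n (Lam : set 'rV[R]_n) S :
  is_lattice Lam -> is_polarization Lam S ->
  exists k (B : 'I_k.+1 -> 'rV[R]_n), is_representatives Lam S B.
Proof.
move=> hLam hS; pose E a b := (qR S @` Lam) (a - b).
have Erefl a : E a a.
  by exists 0; [exact: lattice0|rewrite /qR mul0mx subrr].
have Esym a b : E a b -> E b a.
  move=> [l Ll e]; exists (- l); first exact: latticeN.
  by rewrite /qR mulNmx -[l *m S]/(qR S l) e opprB.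
have Etrans a b c : E a b -> E b c -> E a c.
  move=> [l Ll e] [l' Ll' e']; exists (l + l'); first exact: latticeD.
  by rewrite /qR mulmxDl -[l *m S]/(qR S l) -[l' *m S]/(qR S l') e e' addrA subrK.
pose A := range (qR S) `&` integral.
have [rho hrho] := lattice_cobounded hLam.
have [C C0 hC] := mulmx_norm_le S.
have [s0 hs0] := @finite_integral R n (C * rho).
pose s := [seq a <- s0 | `[< A a >]].
have sA a : a \in s -> A a by rewrite mem_filter => /andP[/asboolP].
have scov a : A a -> exists2 a', a' \in s & E a a'.
  move=> [[y _ yE] aint]; have [l Ll yl] := hrho y.
  have eE : a - qR S l = qR S (y - l) by rewrite -yE /qR mulmxBl.
  have eint : integral (a - qR S l).
    by apply: intvecB => //; exact: (qR_integral hS Ll).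
  exists (a - qR S l).
    rewrite mem_filter; apply/andP; split.
      by apply/asboolP; split=> //; rewrite eE; exists (y - l).
    apply: hs0 => //; rewrite eE; apply: le_trans (hC _) _.
    by rewrite ler_wpM2l.
  by exists l => //; rewrite opprB addrC subrK.
have [t [ut ts cov inj]] := transversal_seq s Erefl Esym.
have tcov a : A a -> exists2 b, b \in t & E a b.
  by move=> /scov[a' /cov[b bt a'b] aa']; exists b => //; exact: Etrans a'b.
(* The class of [0] is represented, so [t] is nonempty and its size is a successor. *)
have [b0 b0t _] : exists2 b, b \in t & E 0 b.
  apply: tcov; split; last exact: intvec0.
  by exists 0 => //; rewrite /qR mul0mx.
have st : size t = (size t).-1.+1 by case: (t) b0t.
exists (size t).-1, (fun i => nth 0 t i).
have lt_t (i : 'I_(size t).-1.+1) : (i < size t)%N.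
  by apply: leq_trans (ltn_ord i) _; rewrite -st.
have nt (i : 'I_(size t).-1.+1) : nth 0 t i \in t by rewrite mem_nth.
split=> [i|a Aa]; first exact/sA/ts/nt.
have [b bt ab] := tcov a Aa.
have ib : (index b t < (size t).-1.+1)%N by rewrite -st index_mem.
exists (Ordinal ib); split=> [|j aj] /=; first by rewrite nth_index.
apply/val_inj => /=; apply/eqP; rewrite -(nth_uniq 0 _ _ ut) ?index_mem //.
rewrite nth_index //; apply/eqP; apply: inj => //.
by apply: Etrans aj; exact: Esym.
Qed.

(** A support of [f] at the origin has integral slope [m] with [m - alpha = y *m S]; thus
    [gamma = m] and [r = - y] serve. *)
Lemma theta_choices_exist (R : realType) n (Lam : set 'rV[R]_n) S alpha f :
  is_lattice Lam -> is_polarization Lam S -> is_theta Lam S alpha f ->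
  exists (r gamma : 'rV[R]_n) (k : nat) (B c : 'I_k.+1 -> 'rV[R]_n),
     theta_choices Lam S alpha r gamma B c.
Proof.
move=> hLam hS fth; have [m mint hm] := regular_support fth.1 0.
have [y yE] := theta_support_range hLam hS fth hm.
have [k [B hB]] := representatives_exist hLam hS.
have hc i : exists c, qR S c = B i by case: (hB.1 i) => -[c _ <-]; exists c.
exists (- y), m, k, B, (fun i => sval (cid (hc i))); split=> //.
  by rewrite /qR mulNmx -yE opprB subrK.
by move=> i; case: cid.
Qed.

Section Coordinates.
Context {R : realType} {n : nat} (Lam : set 'rV[R]_n) (S : 'M[R]_n).
Context (hLam : is_lattice Lam) (hS : is_polarization Lam S).
Local Notation V := 'rV[R]_n.
Context (alpha : V) (f0 : V -> R) (f0th : is_theta Lam S alpha f0).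
Context (r gamma : V) (k : nat) (B c : 'I_k.+1 -> V).
Context (hch : theta_choices Lam S alpha r gamma B c).

Local Notation psd := (theta_psd hLam hS f0th).
Local Notation th i := (theta_fun Lam S r (B i) (c i)).
Local Notation term i := (theta_term S r (B i) (c i)).
Local Notation QRsym := (polarization_sym hS).

Let gint : integral gamma. Proof. by case: hch. Qed.
Let alphaE : alpha = qR S r + gamma. Proof. by case: hch. Qed.
Let Brep : is_representatives Lam S B. Proof. by case: hch. Qed.
Let cB i : qR S (c i) = B i. Proof. by case: hch. Qed.
Let Bint i : integral (B i). Proof. by case: Brep => /(_ i)[]. Qed.

Let ThetaE i x : Theta Lam S r (B i) (c i) x = (th i x)%:E.
Proof. exact: (Theta_fin hLam hS psd r (Bint i) (cB i)). Qed.

Let th_ge i l x : Lam l -> term i l x <= th i x.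
Proof. exact: (theta_fun_ge hLam hS psd r (Bint i) (cB i)). Qed.

Let th_attained i x : exists2 l, Lam l & th i x = term i l x.
Proof. exact: (theta_fun_attained hLam hS psd r (Bint i) (cB i)). Qed.

Let th_shift i l x : Lam l -> th i (x + l) =
  th i x + QR S l x + 2^-1 * QR S l l + QR S r l.
Proof. exact: (theta_fun_shift hLam hS psd r (Bint i) (cB i)). Qed.

Let th_continuous i : continuous (th i).
Proof. exact: (theta_fun_continuous hLam hS psd (Bint i) (cB i)). Qed.

Let term_shift i l l' x : term i l (x + l') =
  term i (l - l') x + QR S l' x + 2^-1 * QR S l' l' + QR S r l'.
Proof. exact: (theta_term_shift hS r (cB i)). Qed.

Definition untwist_fun (f : V -> R) x := f x - pairing gamma x.
Local Notation ut := untwist_fun.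

Lemma untwist_shift f l x : is_theta Lam S alpha f -> Lam l -> ut f (x + l) =
  ut f x + QR S l x + 2^-1 * QR S l l + QR S r l.
Proof.
move=> [_ fq] Ll; rewrite /ut fq // alphaE pairingDl pairingDr -QRE; lra.
Qed.

Definition coordinate (f : V -> R) i : R :=
  fine (phi Lam S r gamma B c (EFin \o f) i).
Local Notation pv := coordinate.

(** Both functions have the same factors of automorphy, so their difference is periodic and
    continuous, and its infimum is a minimum. *)
Lemma phi_attained f i : is_theta Lam S alpha f -> exists x0,
  phi Lam S r gamma B c (EFin \o f) i = (ut f x0 - th i x0)%:E /\
  forall x, ut f x0 - th i x0 <= ut f x - th i x.
Proof.
move=> fth; have [[fc _] _] := fth.
pose h x := ut f x - th i x.
have hc : continuous h.
  move=> x; have h1 := cvgB (fc x) (@pairing_continuous _ _ gamma x).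
  exact: (cvgB (h1 _) (@th_continuous i x)).
have hper x l : Lam l -> h (x + l) = h x.
  by move=> Ll; rewrite /h untwist_shift // th_shift //; lra.
have [x0 hx0] := periodic_min hLam hc hper.
exists x0; split=> //; apply/eqP; rewrite eq_le; apply/andP; split.
  by apply: ereal_inf_lbound; exists x0 => //; rewrite ThetaE.
apply: le_ereal_inf_tmp => _ [x _ <-].
by rewrite ThetaE /untwist /= lee_fin; exact: hx0.
Qed.

Lemma phi_fin f i : is_theta Lam S alpha f ->
  phi Lam S r gamma B c (EFin \o f) i = (pv f i)%:E.
Proof. by move=> /(phi_attained i)[x0 [e _]]; rewrite /pv e. Qed.

Lemma coordinate_le f i x : is_theta Lam S alpha f -> pv f i + th i x <= ut f x.
Proof.
by move=> /(phi_attained i)[x0 [e /(_ x)]]; rewrite /pv e /=; lra.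
Qed.

Lemma coordinate_attained f i : is_theta Lam S alpha f ->
  exists x, ut f x = pv f i + th i x.
Proof.
move=> /(phi_attained i)[x0 [e _]]; exists x0.
by rewrite /pv e /= subrK.
Qed.

(* A support of [f] at [x] has slope [B i + q(l)]; translating the point where
   the i-th minimum is attained, we may assume that [th i] is given there by
   the term of index [l], which has the same slope. *)
Lemma theta_expansion f x : is_theta Lam S alpha f ->
  exists i, ut f x = pv f i + th i x.
Proof.
move=> fth; have [m mint hm] := regular_support fth.1 x.
have [y yE] := theta_support_range hLam hS fth hm.
have mE : m - gamma = qR S (y + r).
  by rewrite /qR mulmxDl -yE alphaE /qR opprD [- _ - gamma]addrC addrA subrK.
have [_ /(_ (m - gamma))] := Brep.
move=> []; first split; [by rewrite mE; exists (y + r)|exact: intvecB|].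
move=> i [[l Ll lE] _]; exists i.
have {}mE : m - gamma = B i + qR S l by rewrite lE [RHS]addrC subrK.
have [x1 hx1] := coordinate_attained i fth.
have [l1 Ll1 thx1] := th_attained i x1.
pose l' := l1 - l; have Ll' : Lam l' by exact: latticeB.
pose x2 := x1 - l'; have x1E : x1 = x2 + l' by rewrite subrK.
have thx2 : th i x2 = term i l x2.
  have e : l1 - l' = l by rewrite /l' opprB addrC subrK.
  by have := thx1; rewrite x1E th_shift // term_shift e; lra.
have utx2 : ut f x2 = pv f i + term i l x2.
  have := hx1; rewrite x1E th_shift // untwist_shift //; lra.
(* The support at [x], evaluated at [x2], gives [ut f x <= pv f i + term i l x]; [coordinate_le]
   gives the reverse bound. *)
have := hm x2; have := th_ge i x Ll; have := coordinate_le i x fth.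
have : pairing (m - gamma) (x2 - x) = term i l x2 - term i l x.
  rewrite mE pairingBr /theta_term; lra.
rewrite pairingBl (pairingBr gamma); move: utx2; rewrite /ut; lra.
Qed.

(** By [theta_expansion], [ut f] is the maximum of the functions [pv f i + th i], so the coordinates
    determine [f]. The case [t = 0] yields injectivity of [phi], general [t] the projective
    equivalence. *)
Lemma coordinate_shift f g t : is_theta Lam S alpha f -> is_theta Lam S alpha g ->
  (forall i, pv f i = pv g i + t) <-> (forall x, f x = g x + t).
Proof.
move=> fth gth; split=> [h x|h i].
  have [i hi] := theta_expansion x fth; have [j hj] := theta_expansion x gth.
  have := coordinate_le j x fth; have := coordinate_le i x gth.
  move: hi hj; rewrite /ut (h i) (h j).
  move: (pv g i) (pv g j) (theta_fun _ _ _ (B i) _ _)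
    (theta_fun _ _ _ (B j) _ _) => *; lra.
have [x hx] := coordinate_attained i fth.
have [y hy] := coordinate_attained i gth.
have := coordinate_le i y fth; have := coordinate_le i x gth.
by move: hx hy; rewrite /ut (h x) (h y); lra.
Qed.

(** These vectors turn out to form the image of [phi]: each [a 0 i + th i] touches the upper
    envelope of all of them. *)
Definition saturated (a : 'rV[R]_k.+1) : Prop :=
  forall i, exists x, forall j, a 0 j + th j x <= a 0 i + th i x.

Lemma coordinate_saturated f : is_theta Lam S alpha f ->
  saturated (\row_i pv f i).
Proof.
move=> fth i; have [x hx] := coordinate_attained i fth; exists x => j.
by have := coordinate_le j x fth; rewrite hx !mxE.
Qed.

(** All [th i] share their factors of automorphy, so a maximum of their translates has them too; it
    is regular because the local families of affine functions can be concatenated. *)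
Lemma tropical_combination (a : 'I_k.+1 -> R) : exists2 f,
  is_theta Lam S alpha f &
  (forall x i, a i + th i x <= ut f x) /\
  forall x, exists i, ut f x = a i + th i x.
Proof.
(* The initial value is itself a member of the family, so it does not alter the maximum. *)
pose f x := \big[Num.max/a ord0 + th ord0 x]_i (a i + th i x) + pairing gamma x.
have f_ge x i : a i + th i x <= ut f x.
  by rewrite /ut /f addrK; apply: (bigmax_sup i).
have f_at x : exists i, ut f x = a i + th i x.
  rewrite /ut /f addrK; elim/big_ind: _ => [|u v [i ->] [j ->]|i _].
  - by exists ord0.
  - by case: leP => _; [exists j|exists i].
  - by exists i.
exists f => //; split; last first.
  move=> l x Ll.
  suff : ut f (x + l) = ut f x + QR S l x + 2^-1 * QR S l l + QR S r l.
    by rewrite /ut alphaE pairingDl pairingDr -QRE; lra.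
  have [i hi] := f_at (x + l); have [j hj] := f_at x.
  have := f_ge x i; have := f_ge (x + l) j; move: hi hj.
  by rewrite !th_shift //; lra.
apply: regularP => x0.
have hloc i := theta_fun_locally_max hLam hS psd r (Bint i) (cB i) x0.
pose s i := sval (cid2 (hloc i)).
have sint i : {in s i, forall p, integral p.1} by rewrite /s; case: cid2.
have snear : \forall x \near x0, forall i,
    {in s i, forall p, affine_eval p x <= th i x} /\
       exists2 p, p \in s i & th i x = affine_eval p x.
  have h i : nbhs x0 [set x | {in s i, forall p, affine_eval p x <= th i x} /\
      exists2 p, p \in s i & th i x = affine_eval p x] by rewrite /s; case: cid2.
  exact: (@filter_forall _ _ _ (nbhs x0) _ h).
pose tw i (p : V * R) := (p.1 + gamma, p.2 + a i).
have twE i p x : affine_eval (tw i p) x = a i + affine_eval p x + pairing gamma x.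
  by rewrite /affine_eval /= pairingDl; lra.
exists (flatten [seq [seq tw i p | p <- s i] | i <- enum 'I_k.+1]).
  move=> _ /flattenP[_ /mapP[i _ ->] /mapP[p ps ->]] /=.
  by apply: intvecD => //; exact: sint ps.
apply: filterS snear => x hx; split.
  move=> _ /flattenP[_ /mapP[i _ ->] /mapP[p ps ->]]; rewrite twE.
  by have := f_ge x i; have := (hx i).1 p ps; rewrite /ut; lra.
have [i hi] := f_at x; have [_ [p ps pE]] := hx i.
exists (tw i p); last by rewrite twE -pE -hi /ut subrK.
apply/flattenP; exists [seq tw i p | p <- s i]; last by apply/mapP; exists p.
by apply/mapP; exists i; rewrite ?mem_enum.
Qed.

(** For the tropical combination [f] of the [th i], the bound [f_ge] gives [a 0 i <= pv f i];
    equality holds because [a 0 i + th i] meets [ut f] at the point given by saturation. *)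
Lemma saturated_coordinate (a : 'rV[R]_k.+1) : saturated a ->
  exists2 f, is_theta Lam S alpha f & forall i, pv f i = a 0 i.
Proof.
move=> asat; have [f fth [f_ge f_at]] := tropical_combination (a 0).
exists f => // i; apply/eqP; rewrite eq_le; apply/andP; split.
  have [x hx] := asat i; have [j hj] := f_at x.
  by have := coordinate_le i x fth; have := hx j; lra.
by have [x hx] := coordinate_attained i fth; have := f_ge x i; lra.
Qed.

(** Where index [i] attains the maximum, [a 0 j - a 0 i] is at most [th i - th j], which is
    continuous and periodic, hence bounded. *)
Lemma saturated_bounded : exists K, forall a, saturated a ->
  forall i j, a 0 j - a 0 i <= K.
Proof.
have hmin (p : 'I_k.+1 * 'I_k.+1) : exists K, forall x, th p.1 x - th p.2 x <= K.
  have [||x0 hx0] := @periodic_min R n Lam hLam (fun x => th p.2 x - th p.1 x).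
  - by move=> x; exact: (cvgB (@th_continuous p.2 x) (@th_continuous p.1 x)).
  - by move=> x l Ll; rewrite !th_shift //; lra.
  by exists (th p.1 x0 - th p.2 x0) => x; have := hx0 x; lra.
pose K p := sval (cid (hmin p)).
have hK p x : th p.1 x - th p.2 x <= K p by rewrite /K; case: cid.
exists (\sum_p `|K p|) => a asat i j; have [x hx] := asat i.
have : `|K (i, j)| <= \sum_p `|K p| by rewrite (bigD1 (i, j)) //= lerDl sumr_ge0.
by have := hK (i, j) x; have := ler_norm (K (i, j)); have := hx j; simpl; lra.
Qed.

(* Translating by the lattice, the term of index [0] of [th i] may be assumed
   maximal at [x]. The inequalities with the terms of index [e] and [- e], for
   [e] in a basis of the lattice, then bound [x *m S], hence [x] modulo the
   kernel of [S], so that only finitely many terms matter. *)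
Lemma saturated_system i : exists s : seq ('rV[R]_k.+1 * V * R),
  forall a : 'rV[R]_k.+1,
  (exists x, forall j, a 0 j + th j x <= a 0 i + th i x) <->
  (exists x, forall h, h \in s -> pairing h.1.1 a + pairing h.1.2 x <= h.2).
Proof.
pose q j l := 2^-1 * QR S (l + c j - r) (l + c j - r).
have q0 j l : 0 <= q j l by rewrite mulr_ge0 // psd.
pose ineq j l : 'rV[R]_k.+1 * V * R :=
  (delta_mx 0 j - delta_mx 0 i, B j + qR S l - B i, q j l - q i 0).
have ineqE j l a x : (pairing (ineq j l).1.1 a + pairing (ineq j l).1.2 x <=
    (ineq j l).2) = (a 0 j + term j l x <= a 0 i + term i 0 x).
  have pd j' : pairing (delta_mx 0 j') a = a 0 j'.
    by rewrite pairingC pairingE trmx_delta -colE mxE.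
  rewrite /= !pairingBl !pd /theta_term -/(q j l) -/(q i 0).
  have -> : qR S 0 = 0 by rewrite /qR mul0mx.
  rewrite addr0; apply/idP/idP; lra.
have [sL [C [sLam C0 hC]]] := lattice_basis_bound hLam.
pose K := \sum_(e <- sL) (q i e + q i (- e)).
have qK e : e \in sL -> q i e + q i (- e) <= K.
  move=> es; rewrite /K (big_rem e) //= lerDl.
  by apply: sumr_ge0 => e' _; rewrite addr_ge0.
have K0 : 0 <= K by apply: sumr_ge0 => e' _; rewrite addr_ge0.
have [C' C'0 hC'] := bounded_preimage S.
(* [C * K] will bound [x *m S], and [C'] is the cost of replacing [x] by a small vector with the
   same image. *)
pose rho := C' * (C * K).
have hF j := theta_fun_finite hLam hS psd r (Bint j) (cB j) rho.
pose F j := sval (cid (hF j)).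
have FL j : {in F j, forall l, Lam l} by rewrite /F; case: cid => ? [].
have Fmax j x : `|x| <= rho -> exists2 l, l \in F j & th j x = term j l x.
  by rewrite /F; case: cid => F' [F'L h] /=; exact: h.
exists [seq ineq j l | j <- enum 'I_k.+1, l <- F j ++ sL ++ map -%R sL] => a.
split=> [[x hx]|[x hx]].
  have [l Ll le] := th_attained i x.
  have [x' xE] : exists x', x = x' + l by exists (x - l); rewrite subrK.
  have th0 : th i x' = term i 0 x'.
    have e : l - l = 0 by rewrite subrr.
    by have := le; rewrite xE th_shift // term_shift e; lra.
  exists x' => _ /allpairsPdep[j [l' [_ l's ->]]]; rewrite ineqE.
  have Ll' : Lam l'.
    move: l's; rewrite !mem_cat => /orP[/FL//|/orP[/sLam//|/mapP[e /sLam Le ->]]].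
    exact: latticeN.
  have := hx j; have := th_ge j x' Ll'; rewrite -th0 xE !th_shift //; lra.
have {}hx j l : l \in F j ++ sL ++ map -%R sL ->
    a 0 j + term j l x <= a 0 i + term i 0 x.
  move=> ls; rewrite -ineqE; apply: hx.
  by apply/allpairsPdep; exists j, l; rewrite mem_enum.
have [x' x'S x'n] := hC' x.
have xS : `|x *m S| <= C * K.
  apply: hC => // e es.
  (* Comparing terms of the same [th i] cancels [a 0 i] and [B i]; the indices [e] and [- e] give
     the two sides of the bound. *)
  have h1 : a 0 i + term i e x <= a 0 i + term i 0 x.
    by apply: hx; rewrite !mem_cat es orbT.
  have h2 : a 0 i + term i (- e) x <= a 0 i + term i 0 x.
    by apply: hx; rewrite !mem_cat map_f ?orbT.
  move: h1 h2 (qK e es) (q0 i e) (q0 i (- e)) (q0 i 0).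
  rewrite pairingC -QRE QRsym QRE /theta_term -!/(q _ _) /qR mul0mx mulNmx.
  rewrite !pairingDl pairingNl pairing0l ler_norml => *.
  apply/andP; split; lra.
have x'rho : `|x'| <= rho by apply: le_trans x'n _; rewrite ler_wpM2l.
(* Differences of slopes lie in the range of [qR S], so they take equal values at [x] and [x'],
   whose images under [S] agree. *)
have hx' j l : l \in F j -> a 0 j + term j l x' <= a 0 i + term i 0 x'.
  move=> lF; have := hx j l; rewrite mem_cat lF => /(_ isT).
  have e : pairing (B j + qR S l - B i) x' = pairing (B j + qR S l - B i) x.
    rewrite -!cB /qR -mulmxDl -mulmxBl -!QRE QRsym QRE x'S.
    by rewrite -QRE QRsym.
  move: e; rewrite -!ineqE /= => ->; exact.
exists x' => j; have [l lF ->] := Fmax j x' x'rho.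
apply: le_trans (hx' j l lF) _; rewrite lerD2l.
exact: th_ge (lattice0 hLam).
Qed.

(** For each [i], Fourier-Motzkin elimination removes the point [x]; concatenating the systems over
    [i] intersects their solution sets. *)
Lemma saturated_polyhedral : exists s, [set a | saturated a] = solset s.
Proof.
have hsys i : exists s, forall a : 'rV[R]_k.+1,
    (exists x, forall j, a 0 j + th j x <= a 0 i + th i x) <-> solset s a.
  have [s hs] := saturated_system i; have [s' hs'] := fourier_motzkin s.
  by exists s' => a; rewrite hs hs'.
pose s i := sval (cid (hsys i)).
have hs i (a : 'rV[R]_k.+1) :
  (exists x, forall j, a 0 j + th j x <= a 0 i + th i x) <->
  solset (s i) a by rewrite /s; case: cid.
exists (flatten [seq s i | i <- enum 'I_k.+1]).
apply/seteqP; split=> a.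
  by move=> asat h /flattenP[_ /mapP[i _ ->]]; exact: (hs i a).1.
move=> asol i; apply/hs => h hi; apply: asol; apply/flattenP; exists (s i) => //.
by apply/mapP; exists i; rewrite ?mem_enum.
Qed.

End Coordinates.

(** * The polyhedron and its projectivization *)

Section Slice.
Context {R : realType} {k : nat} (i0 : 'I_k.+1).

(** The section of the quotient by the diagonal whose values have coordinate [i0] equal to zero. *)
Definition insert0 (y : 'rV[R]_k) : 'rV[R]_k.+1 :=
  \row_j oapp (y 0) 0 (unlift i0 j).

Lemma insert0_at y : insert0 y 0 i0 = 0.
Proof. by rewrite mxE unlift_none. Qed.

Lemma insert0_lift y j : insert0 y 0 (lift i0 j) = y 0 j.
Proof. by rewrite mxE liftK. Qed.

Lemma pairing_insert0 h y :
  pairing h (insert0 y) = pairing (\row_j h 0 (lift i0 j)) y.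
Proof.
rewrite /pairing (bigD1_ord i0) //= insert0_at mulr0 add0r.
by apply: eq_bigr => j _; rewrite insert0_lift mxE.
Qed.

Lemma insert0_solset (s : seq ('rV[R]_k.+1 * R)) :
  exists s', [set y | solset s (insert0 y)] = solset s'.
Proof.
exists [seq (\row_j h.1 0 (lift i0 j), h.2) | h : 'rV[R]_k.+1 * R <- s].
apply/seteqP; split=> y hy => [_ /mapP[h hs ->] /=|h hs].
  by rewrite -pairing_insert0; exact: hy.
rewrite pairing_insert0; apply: (hy (\row_j h.1 0 (lift i0 j), h.2)).
by apply/mapP; exists h.
Qed.

End Slice.

Lemma solset_convex (R : realType) m (s : seq ('rV[R]_m * R)) x y t :
  solset s x -> solset s y -> 0 <= t <= 1 -> solset s (x + t *: (y - x)).
Proof.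
move=> hx hy /andP[t0 t1] h hs; rewrite pairingDr pairingZr pairingBr.
have := hx h hs; have := hy h hs; move: (pairing _ _) (pairing _ _) => *; nra.
Qed.

Section Polyhedron.
Context {R : realType} {n : nat} (Lam : set 'rV[R]_n) (S : 'M[R]_n).
Context (hLam : is_lattice Lam) (hS : is_polarization Lam S).
Local Notation V := 'rV[R]_n.
Context (alpha : V) (f0 : V -> R) (f0th : is_theta Lam S alpha f0).
Context (r gamma : V) (k : nat) (B c : 'I_k.+1 -> V).
Context (hch : theta_choices Lam S alpha r gamma B c).

Local Notation G := (Gamma Lam S alpha).
Local Notation G' := (G `\` [set minus_infty]).
Local Notation phi := (phi Lam S r gamma B c).
Local Notation pv := (coordinate Lam S r gamma B c).
Local Notation sat := (saturated Lam S r B c).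

Lemma GammaD1P s : G' s <-> exists2 f, is_theta Lam S alpha f & s = EFin \o f.
Proof.
split=> [[[->|[f fth <-]] sn]|[f fth ->]]; first by case: sn.
  by exists f.
split; first by right; exists f.
by move=> /(congr1 (fun g => g 0)).
Qed.

Lemma phi_minus_infty i : phi minus_infty i = -oo%E.
Proof.
by apply/eqP; rewrite -leeNy_eq; apply: ereal_inf_lbound; exists 0.
Qed.

Lemma phi_injective s s' : G s -> G s' -> phi s = phi s' -> s = s'.
Proof.
have finite f i : is_theta Lam S alpha f -> phi (EFin \o f) i = (pv f i)%:E.
  exact: (phi_fin hLam hS f0th hch).
move=> [->|[f fth <-]] [->|[g gth <-]] // e.
- by have := congr1 (@^~ ord0) e; rewrite finite // phi_minus_infty.
- by have := congr1 (@^~ ord0) e; rewrite finite // phi_minus_infty.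
apply/funext => x; congr (_%:E).
have := (coordinate_shift hLam hS f0th hch 0 fth gth).1.
rewrite -[RHS]addr0; apply=> i.
by have := congr1 (@^~ i) e; rewrite !finite // addr0 => -[].
Qed.

Lemma phi_image : phi @` G' = @toT R k.+1 @` [set a | sat a].
Proof.
apply/seteqP; split=> [_ [s /GammaD1P[f fth ->] <-]|_ [a asat <-]].
  exists (\row_i pv f i).
    exact: (coordinate_saturated hLam hS f0th hch fth).
  apply/funext => i; rewrite /toT mxE.
  by rewrite (phi_fin hLam hS f0th hch i fth).
have [f fth fE] := saturated_coordinate hLam hS f0th hch asat.
exists (EFin \o f); first by apply/GammaD1P; exists f.
by apply/funext => i; rewrite (phi_fin hLam hS f0th hch i fth) fE.
Qed.

Lemma saturated_shift (a b : 'rV[R]_k.+1) t : (forall i, b 0 i = a 0 i + t) ->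
  sat a -> sat b.
Proof.
move=> ab asat i; have [x hx] := asat i; exists x => j.
by have := hx j; rewrite !ab ![_ + t + _]addrAC lerD2r.
Qed.

Context (i0 : 'I_k.+1).
Local Notation p := (proj_phi Lam S r gamma B c i0).

Lemma proj_phiE f j : p (EFin \o f) 0 j = pv f (lift i0 j) - pv f i0.
Proof. by rewrite mxE. Qed.

(** Subtracting the coordinate of index [i0] preserves saturation and moves a coordinate vector into
    the slice. *)
Lemma proj_image : p @` G' = [set y | sat (insert0 i0 y)].
Proof.
apply/seteqP; split=> [_ [s /GammaD1P[f fth ->] <-] /=|y /= ysat].
  apply: (@saturated_shift (\row_i pv f i) _ (- pv f i0)); last first.
    exact: (coordinate_saturated hLam hS f0th hch fth).
  move=> i; rewrite [X in _ = X - _]mxE; have [j ->|->] := unliftP i0 i.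
    by rewrite insert0_lift proj_phiE.
  by rewrite insert0_at subrr.
have [f fth fE] := saturated_coordinate hLam hS f0th hch ysat.
exists (EFin \o f); first by apply/GammaD1P; exists f.
by apply/rowP => j; rewrite proj_phiE !fE insert0_at subr0 insert0_lift.
Qed.

(** Equal differences of coordinates mean that the coordinates differ by the constant
    [pv g i0 - pv f i0]; by [coordinate_shift] the functions then differ by it too. *)
Lemma proj_phi_eq s s' : G' s -> G' s' -> p s = p s' <-> proj_equiv s s'.
Proof.
move=> /GammaD1P[f fth ->] /GammaD1P[g gth ->].
have shift t := coordinate_shift hLam hS f0th hch t gth fth.
split=> [e|[t e]].
  have gf : forall x, g x = f x + (pv g i0 - pv f i0).
    apply/(shift (pv g i0 - pv f i0)) => i.
    have [j ->|->] := unliftP i0 i; last by rewrite addrC subrK.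
    have := congr1 (fun y : 'rV[R]_k => y 0 j) e; rewrite !proj_phiE => e'.
    by rewrite addrCA e' addrC subrK.
  exists (pv g i0 - pv f i0); apply/funext => x.
  by rewrite /= -EFinD; congr (_%:E); exact: gf.
have gf x : g x = f x + t by have := congr1 (@^~ x) e => /= -[].
apply/rowP => j; rewrite !proj_phiE !((shift t).2 gf).
by rewrite opprD addrACA subrr addr0.
Qed.

(** In the slice each coordinate is a difference with the zero entry at [i0], so [saturated_bounded]
    applies in both orders. *)
Lemma proj_bounded : exists K, forall y, (p @` G') y -> `|y| <= K.
Proof.
have [K hK] := saturated_bounded hLam hS f0th hch.
exists `|K| => y; rewrite proj_image => ysat.
apply: rV_norm_leP => // j; rewrite ler_norml.
have := hK _ ysat i0 (lift i0 j); have := hK _ ysat (lift i0 j) i0.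
rewrite insert0_at insert0_lift; have := ler_norm K => *.
by apply/andP; split; lra.
Qed.

Lemma proj_polyhedral : exists s, p @` G' = solset s.
Proof.
have [s hs] := saturated_polyhedral hLam hS f0th hch.
have [s' s'E] := insert0_solset i0 s; exists s'.
by rewrite proj_image -s'E -hs.
Qed.

End Polyhedron.

Theorem theorem2 (R : realType) (n : nat) (Lam : set 'rV[R]_n)
    (S : 'M[R]_n) (alpha : 'rV[R]_n)
    (hLam : is_lattice Lam) (hS : is_polarization Lam S)
    (hGamma : Gamma Lam S alpha <> [set minus_infty]) :
  (exists (r gamma : 'rV[R]_n) (k : nat) (B c : 'I_k.+1 -> 'rV[R]_n),
     theta_choices Lam S alpha r gamma B c) /\
  forall (r gamma : 'rV[R]_n) (k : nat) (B c : 'I_k.+1 -> 'rV[R]_n),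
    theta_choices Lam S alpha r gamma B c ->
    let G := Gamma Lam S alpha in
    let G' := G `\` [set minus_infty] in
    [/\ (* the maxima and minima defining phi are attained *)
        (forall i x, exists2 l, Lam l &
           Theta Lam S r (B i) (c i) x = (theta_term S r (B i) (c i) l x)%:E) /\
        (forall s i, G' s -> exists x,
           phi Lam S r gamma B c s i
           = (untwist gamma s x - Theta Lam S r (B i) (c i) x)%E),
        (* phi is injective on Gamma(X, L) *)
        (forall s s', G s -> G s' ->
           phi Lam S r gamma B c s = phi Lam S r gamma B c s' -> s = s'),
        (* phi identifies Gamma(X, L) with a convex polyhedron in R^B *)
        (exists2 P : set 'rV[R]_k.+1, is_polyhedron P &
           phi Lam S r gamma B c @` G' = @toT R k.+1 @` P) &
        (* and the projectivization with a compact, pure-dimensional one *)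
        forall i0 : 'I_k.+1,
          let p := proj_phi Lam S r gamma B c i0 in
          [/\ forall s s', G' s -> G' s' -> p s = p s' <-> proj_equiv s s',
              is_polyhedron (p @` G'), compact (p @` G') &
              pure_dimensional (p @` G')]].
Proof.
(* As [minus_infty] always lies in [Gamma], the hypothesis yields a real-valued theta function. *)
have [f0 f0th] : exists f0, is_theta Lam S alpha f0.
  apply: contrapT => h; apply: hGamma.
  apply/seteqP; split=> [s [//|[f fth _]]|s ->]; first by case: h; exists f.
  by left.
split; first exact: theta_choices_exist f0th.
move=> r gamma k B c hch /=.
have psd := theta_psd hLam hS f0th.
have [gint alphaE Brep cB] := hch.
have Bint i : Defs.integral (B i) by case: Brep => /(_ i)[].
have G'f0 : (Gamma Lam S alpha `\` [set minus_infty]) (EFin \o f0).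
  by apply/GammaD1P; exists f0.
split.
- split=> [i x|s i /GammaD1P[f fth ->]].
    by have [l Ll [e _]] := Theta_max hLam hS psd r (Bint i) (cB i) x; exists l.
  have [x [e _]] := phi_attained hLam hS f0th hch i fth; exists x.
  by rewrite e (Theta_fin hLam hS psd r (Bint i) (cB i)).
- exact: (phi_injective hLam hS f0th hch).
- exists [set a | saturated Lam S r B c a]; last first.
    exact: (phi_image hLam hS f0th hch).
  have [s sE] := saturated_polyhedral hLam hS f0th hch; rewrite sE.
  apply: solset_polyhedron; rewrite -sE.
  exists (\row_i coordinate Lam S r gamma B c f0 i).
  exact: (coordinate_saturated hLam hS f0th hch f0th).
move=> i0; have [s sE] := proj_polyhedral hLam hS f0th hch i0.
have [K hK] := proj_bounded hLam hS f0th hch i0.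
have ne : proj_phi Lam S r gamma B c i0 @`
    (Gamma Lam S alpha `\` [set minus_infty]) !=set0.
  by exists (proj_phi Lam S r gamma B c i0 (EFin \o f0)); exists (EFin \o f0).
split; first exact: (proj_phi_eq hLam hS f0th hch).
- by rewrite sE; apply: solset_polyhedron; rewrite -sE.
- apply: subclosed_compact (@closed_ball_compact _ _ K) hK.
  by rewrite sE; exact: solset_closed.
- by apply: convex_pure_dimensional => //; rewrite sE; exact: solset_convex.
Qed.
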